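(* Let $(E,\mathcal F,\mu)$ be a probability space and let $P$ be a Markov operator on $L^2(\mu)$ with $\mu P=\mu$ which is ergodic (i.e. $1$ is a simple eigenvalue of $P$). Let $P^*$ be the adjoint of $P$ on $L^2(\mu)$ and $\hat P=\frac12(P+P^* )$. Then the following statements are equivalent: (1) There is a constant $\theta\in[-1,1)$ such that the Poincar\'e inequality $$\mu(f^2)\le \frac{1}{1-\theta}\,\mu\big(f(f-Pf)\big)+\mu(f)^2,\qquad f\in L^2(\mu),$$ holds, i.e. $\hat P$ has a spectral gap ($1$ is an isolated point of the spectrum of $\hat P$). (2) $\|P\|_\tau<1$. (3) $\inf_{m\in\mathbb N}\|P^{2m-1}\|_\tau<1$. (4) $\inf_{m\in\mathbb N}\|\hat P^{m}\|_{tail}<1$.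
   Context: A Markov operator on $L^2(\mu)$ is a linear operator $P$ on $L^2(\mu)$ with $P1=1$ and $Pf\ge0$ whenever $f\ge0$; $\mu P=\mu$ means $\mu(Pf)=\mu(f)$ for all $f$. For a bounded operator $Q$ on $L^2(\mu)$ the tail norms are $$\|Q\|_\tau:=\lim_{R\to\infty}\sup_{\mu(f^2)\le1}\mu\big(f(Qf-R)^+\big),\qquad \|Q\|_{tail}:=\lim_{R\to\infty}\sup_{\mu(f^2)\le1}\mu\Big(\big((|Qf|-R)^+\big)^2\Big)^{1/2}.$$ *)

(* Defs.v *)
From HB Require Import structures.
From mathcomp Require Import all_boot all_order all_algebra.
From mathcomp Require Import all_classical all_reals all_analysis.
Set Implicit Arguments. Unset Strict Implicit. Unset Printing Implicit Defensive.
Import Order.TTheory GRing.Theory Num.Theory.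
Import numFieldNormedType.Exports.
Local Open Scope classical_set_scope.
Local Open Scope ring_scope.

Section Defs.
Context {d : measure_display} {T : measurableType d} {R : realType}.
Variable mu : probability T R.

Definition L2 (f : T -> R) : Prop :=
  measurable_fun setT f /\ mu.-integrable setT (fun x => (f x ^+ 2)%:E).

(* operators on L^2(mu), acting on representatives *)
Definition operator := (T -> R) -> (T -> R).

Definition L2_linear_op (Q : operator) : Prop :=
  [/\ (forall f, L2 f -> L2 (Q f)),
      (forall f g, L2 f -> L2 g -> {ae mu, forall x, f x = g x} ->
          {ae mu, forall x, Q f x = Q g x}) &
      (forall (a b : R) f g, L2 f -> L2 g ->
          {ae mu, forall x, Q (fun y => a * f y + b * g y) x = a * Q f x + b * Q g x})].

Definition Markov_op (P : operator) : Prop :=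
  [/\ L2_linear_op P,
      {ae mu, forall x, P (fun _ => 1) x = 1} &
      (forall f, L2 f -> {ae mu, forall x, 0 <= f x} -> {ae mu, forall x, 0 <= P f x})].

Definition mu_invariant (P : operator) : Prop :=
  forall f, L2 f -> Rintegral mu setT (P f) = Rintegral mu setT f.

Definition ergodic (P : operator) : Prop :=
  forall f, L2 f -> {ae mu, forall x, P f x = f x} ->
    exists c : R, {ae mu, forall x, f x = c}.

Definition is_adjoint (P Ps : operator) : Prop :=
  L2_linear_op Ps /\
  forall f g, L2 f -> L2 g ->
    Rintegral mu setT (fun x => g x * P f x) = Rintegral mu setT (fun x => Ps g x * f x).

Definition symmetrization (P Ps : operator) : operator :=
  fun f x => (P f x + Ps f x) / 2.

Definition unit_ball := [set f : T -> R | L2 f /\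
  (\int[mu]_x ((f x ^+ 2)%:E) <= 1)%E].

Definition tau_norm (Q : operator) : \bar R :=
  lim ((fun r : R => ereal_sup [set (\int[mu]_x ((f x * Num.max (Q f x - r) 0)%:E))%E
                                 | f in unit_ball]) @ +oo%R).

Definition tail_norm (Q : operator) : \bar R :=
  lim ((fun r : R => ereal_sup [set poweR (\int[mu]_x ((Num.max (`|Q f x| - r) 0) ^+ 2)%:E)%E 2^-1
                                 | f in unit_ball]) @ +oo%R).

End Defs.

(* Main.v *)
(** Write [E f = mu (f (f - P f))]. If the Poincare inequality fails there are
    normalized centred [f] with [E f] as small as we like, and the heart of the
    proof is that there are then also functions which are almost fixed by [P]
    and supported on sets of arbitrarily small measure; such functions force
    every [|P^n|_tau] and every [|Phat^n|_tail] to be at least 1. Suppose there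
    are none. Then the squares [f^2] are uniformly integrable, and truncating
    gives [[0,1]]-valued functions with small energy whose means stay away from
    0 and whose supports stay away from full measure. By the mean ergodic
    theorem such functions are asymptotically independent of any fixed function,
    so the minimum of several of them, chosen one after the other, has small
    energy and small but nonempty support: a contradiction.
    Conversely, the Poincare inequality bounds both norms, because
    [(P f - R)^+ <= P ((f - K)^+)] for [f >= 0] and [K <= R], and [(f - K)^+] has
    mean at most [1 / K]. For the tail norm one also needs the spectrum of [Phat]
    near [-1]; it is controlled by [- <w, Phat w> <= <|w|, Phat |w|>]. *)
Require Import Defs.
From HB Require Import structures.
From mathcomp Require Import all_boot all_order all_algebra.
From mathcomp Require Import all_classical all_reals all_analysis.
From mathcomp Require Import measurable_realfun ring lra.
Import Order.TTheory GRing.Theory Num.Theory.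
Import numFieldNormedType.Exports.
Local Open Scope classical_set_scope.
Local Open Scope ring_scope.

Set Implicit Arguments. Unset Strict Implicit. Unset Printing Implicit Defensive.

(** * The space of square-integrable functions *)

Section L2_stability.
Context {d : measure_display} {T : measurableType d} {R : realType}.
Variable mu : probability T R.

Lemma L2_le (f g : T -> R) : measurable_fun setT f -> L2 mu g ->
  (forall x, `|f x| <= `|g x|) -> L2 mu f.
Proof.
move=> mf [mg ig] fg; split=> //; apply: le_integrable ig => //.
  by apply/measurable_EFinP; exact: measurable_funX.
move=> x _; rewrite !abse_EFin lee_fin !normrX.
by apply: lerXn2r => //; rewrite nnegrE.
Qed.

Lemma integrable_L2_mul (f g : T -> R) : L2 mu f -> L2 mu g ->
  mu.-integrable setT (fun x => (f x * g x)%:E).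
Proof.
move=> [mf if2] [mg ig].
apply: le_integrable (integrableD measurableT if2 ig) => //.
  by apply/measurable_EFinP; exact: measurable_funM.
move=> x _ /=; rewrite lee_fin normrM.
have := sqr_ge0 (`|f x| - `|g x|).
have : f x ^+ 2 + g x ^+ 2 <= `|f x ^+ 2 + g x ^+ 2| by exact: ler_norm.
have := real_normK (num_real (f x)); have := real_normK (num_real (g x)).
have := normr_ge0 (f x); have := normr_ge0 (g x).
nra.
Qed.

Lemma L2_cst (c : R) : L2 mu (cst c).
Proof.
split; first exact: measurable_cst.
exact: (@finite_measure_integrable_cst _ _ _ mu _ (c ^+ 2) measurableT).
Qed.

Lemma L2_submod : submod_closed (fun f : T -> R => `[< L2 mu f >]).
Proof.
split; first by apply/asboolP; exact: L2_cst.
move=> a f g /asboolP Lf /asboolP Lg; apply/asboolP.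
have [[mf if2] [mg ig]] := (Lf, Lg); split.
  by apply: measurable_funD => //; exact: measurable_funM.
have -> : (fun x => ((a *: f + g) x ^+ 2)%:E) =
  (fun x => ((a ^+ 2)%:E * (f x ^+ 2)%:E) + ((2 * a)%:E * (f x * g x)%:E + (g x ^+ 2)%:E))%E.
  by apply/funext => x; rewrite -!EFinM -!EFinD; congr (_%:E); rewrite !fctE /GRing.scale/=; ring.
apply: integrableD => //; first exact: integrableZl.
by apply: integrableD => //; apply: integrableZl => //; exact: integrable_L2_mul.
Qed.

End L2_stability.

Section L2_space.
Context {d : measure_display} {T : measurableType d} {R : realType}.
Variable mu : probability T R.

Definition L2pred : {pred (T -> R)} := fun f => `[< L2 mu f >].

(** Elements are functions rather than classes modulo null sets, so the module structure is the
    pointwise one and [dot] is only semidefinite; almost-everywhere equality is carried separately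
    by [aeq]. *)
Record l2 := MkL2 { l2fun :> T -> R; l2fun_in : l2fun \in L2pred }.

HB.instance Definition _ := [isSub for l2fun].
HB.instance Definition _ := [Choice of l2 by <:].
HB.instance Definition _ := GRing.isSubmodClosed.Build _ _ L2pred (L2_submod mu).
HB.instance Definition _ := [SubChoice_isSubLmodule of l2 by <:].

Lemma l2P (u : l2) : L2 mu u.
Proof. exact/asboolP/(valP u). Qed.

Definition mkL2 f (Lf : L2 mu f) : l2 := MkL2 (asboolT Lf).

Lemma l2D (u v : l2) x : (u + v) x = u x + v x. Proof. by []. Qed.
Lemma l2N (u : l2) x : (- u) x = - u x. Proof. by []. Qed.
Lemma l2Z a (u : l2) x : (a *: u) x = a * u x. Proof. by []. Qed.
Lemma l20 x : (0 : l2) x = 0. Proof. by []. Qed.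

Lemma vpos_subproof (u : l2) : L2 mu (fun x => Num.max (u x) 0).
Proof.
apply: (L2_le (g := u)) (l2P u) _.
  by apply: measurable_maxr => //; have [] := l2P u.
by move=> x; rewrite /Num.max; case: ifPn => // _; rewrite normr0.
Qed.
Definition vpos u := mkL2 (vpos_subproof u).
Definition l2one : l2 := mkL2 (L2_cst mu 1).

Lemma vposE u x : vpos u x = Num.max (u x) 0. Proof. by []. Qed.
Lemma l2oneE x : l2one x = 1. Proof. by []. Qed.

Definition l2E := (vposE, l2oneE, l2D, l2N, l2Z, l20).

Definition dot (u v : l2) := Rintegral mu setT (fun x => u x * v x).

Lemma dotC u v : dot u v = dot v u.
Proof. by rewrite /dot; apply: eq_Rintegral => x _; rewrite mulrC. Qed.

Lemma dotDl u v w : dot (u + v) w = dot u w + dot v w.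
Proof.
rewrite /dot -RintegralD//; try by apply: integrable_L2_mul; exact: l2P.
by apply: eq_Rintegral => x _; rewrite l2D mulrDl.
Qed.

Lemma dotZl a u w : dot (a *: u) w = a * dot u w.
Proof.
rewrite /dot -RintegralZl//; try by apply: integrable_L2_mul; exact: l2P.
by apply: eq_Rintegral => x _; rewrite l2Z mulrA.
Qed.

Lemma dotNl u w : dot (- u) w = - dot u w.
Proof. by rewrite -scaleN1r dotZl mulN1r. Qed.
Lemma dotBl u v w : dot (u - v) w = dot u w - dot v w.
Proof. by rewrite dotDl dotNl. Qed.
Lemma dot0l w : dot 0 w = 0.
Proof. by rewrite -(subrr w) dotBl subrr. Qed.
Lemma dotDr u v w : dot w (u + v) = dot w u + dot w v.
Proof. by rewrite dotC dotDl !(dotC w). Qed.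
Lemma dotZr a u w : dot w (a *: u) = a * dot w u.
Proof. by rewrite dotC dotZl !(dotC w). Qed.
Lemma dotNr u w : dot w (- u) = - dot w u.
Proof. by rewrite dotC dotNl !(dotC w). Qed.
Lemma dotBr u v w : dot w (u - v) = dot w u - dot w v.
Proof. by rewrite dotDr dotNr. Qed.

Definition dotE := (dotDl, dotDr, dotNl, dotNr, dotZl, dotZr).

Definition aeq (f g : T -> R) := {ae mu, forall x, f x = g x}.
Definition ale (f g : T -> R) := {ae mu, forall x, f x <= g x}.

Lemma dot_ae (u v u' v' : l2) :
  {ae mu, forall x, u x * v x <= u' x * v' x} -> dot u v <= dot u' v'.
Proof.
move=> uv; rewrite -subr_ge0 /dot -RintegralB//; try by apply: integrable_L2_mul; exact: l2P.
rewrite /Rintegral.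
have mm : measurable_fun setT (fun x => u' x * v' x - u x * v x).
  have [[m1 _] [m2 _]] := (l2P u, l2P v); have [[m3 _] [m4 _]] := (l2P u', l2P v').
  by apply: measurable_funB; apply: measurable_funM.
(* The positive part is nonnegative everywhere and agrees with the integrand outside a null set. *)
rewrite (ae_eq_integral (fun x => (Num.max (u' x * v' x - u x * v x) 0)%:E))//.
- by apply: fine_ge0; apply: integral_ge0 => x _; rewrite lee_fin le_max lexx orbT.
- exact/measurable_EFinP.
- by apply/measurable_EFinP; apply: measurable_maxr.
- apply: filterS uv => x /= h _; congr (_%:E).
  by apply/esym/max_idPl; rewrite subr_ge0.
Qed.

Lemma dot_le (u v u' v' : l2) :
  (forall x, u x * v x <= u' x * v' x) -> dot u v <= dot u' v'.
Proof. by move=> h; apply: dot_ae; exact: aeW. Qed.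

Lemma dot_aeq (u u' v : l2) : aeq u u' -> dot u v = dot u' v.
Proof.
move=> h; apply/eqP; rewrite eq_le; apply/andP; split; apply: dot_ae.
  by apply: filterS h => x /= ->.
by apply: filterS h => x /= ->.
Qed.

Lemma dot_ge0 (u v : l2) : ale (cst 0) u -> ale (cst 0) v -> 0 <= dot u v.
Proof.
move=> u0 v0; rewrite -(dot0l 0).
by apply: dot_ae; apply: filterS2 u0 v0 => x /= u0 v0; rewrite ?l20 mul0r mulr_ge0.
Qed.

Lemma dot_sqr_ge0 u : 0 <= dot u u.
Proof.
rewrite -(dot0l 0).
by apply: dot_le => x; rewrite l20 mul0r -expr2 sqr_ge0.
Qed.

Lemma dot_eq0 u : dot u u = 0 -> aeq u (cst 0).
Proof.
move=> h.
have iu := integrable_L2_mul (l2P u) (l2P u).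
have [+ _] := @ae_eq_integral_abs _ _ _ mu setT measurableT (fun x => (u x * u x)%:E) (measurable_int _ iu).
have -> : (\int[mu]_x `|(u x * u x)%:E| = \int[mu]_x (u x * u x)%:E)%E.
  by apply: eq_integral => x _; rewrite gee0_abs// lee_fin -expr2 sqr_ge0.
have -> : (\int[mu]_x (u x * u x)%:E = 0)%E.
  rewrite -[LHS]fineK; first by congr (_%:E); exact: h.
  exact: integrable_fin_num.
move=> /(_ erefl); apply: filterS => x /= /(_ I)[] /eqP.
by rewrite mulf_eq0 orbb => /eqP.
Qed.

End L2_space.

(** * Norm, Cauchy-Schwarz and truncation *)

Section norm.
Context {d : measure_display} {T : measurableType d} {R : realType}.
Variable mu : probability T R.
Local Notation V := (l2 mu).
Implicit Types u v w : V.

Definition nrm u := Num.sqrt (dot u u).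

Lemma nrm_ge0 u : 0 <= nrm u. Proof. exact: sqrtr_ge0. Qed.
Lemma nrm_sqr u : nrm u ^+ 2 = dot u u.
Proof. by rewrite sqr_sqrtr// dot_sqr_ge0. Qed.

Lemma nrm_le u (c : R) : 0 <= c -> (nrm u <= c) = (dot u u <= c ^+ 2).
Proof. by move=> c0; rewrite -nrm_sqr ler_pXn2r ?nnegrE ?nrm_ge0. Qed.

Lemma dot_CS u v : dot u v ^+ 2 <= dot u u * dot v v.
Proof.
have h (a b : R) : 0 <= a ^+ 2 * dot u u - 2 * a * b * dot u v + b ^+ 2 * dot v v.
  have := dot_sqr_ge0 (a *: u - b *: v).
  rewrite !dotE (dotC v u); lra.
have [v0|v0] := eqVneq (dot v v) 0.
  rewrite v0 mulr0; have [->|uv0] := eqVneq (dot u v) 0; first by rewrite expr0n.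
  (* With [dot v v = 0] the form is affine in [b]; this [b] gives it the negative value
     [dot u u - 2 * (dot u u + 1)]. *)
  have := h 1 ((dot u u + 1) / dot u v); rewrite v0 mulr1 -mulrA mulfVK//.
  have := dot_sqr_ge0 u; lra.
have {}v0 : 0 < dot v v by rewrite lt_def v0 dot_sqr_ge0.
have := h (dot v v) (dot u v); rewrite -(ler_pM2l v0).
lra.
Qed.

Lemma dot_le_nrm u v : dot u v <= nrm u * nrm v.
Proof.
have [h|h] := leP (dot u v) 0; first by rewrite (le_trans h)// mulr_ge0 ?nrm_ge0.
have uv0 : 0 <= nrm u * nrm v by rewrite mulr_ge0 ?nrm_ge0.
rewrite -(@ler_pXn2r _ 2 isT (dot u v)) ?nnegrE ?(ltW h)//.
by rewrite exprMn !nrm_sqr dot_CS.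
Qed.

Lemma nrmD u v : nrm (u + v) <= nrm u + nrm v.
Proof.
rewrite nrm_le ?addr_ge0 ?nrm_ge0// sqrrD !nrm_sqr !dotE (dotC v u).
have := dot_le_nrm u v; lra.
Qed.

Lemma nrmN u : nrm (- u) = nrm u.
Proof. by rewrite /nrm dotNl dotNr opprK. Qed.

Lemma nrmZ a u : 0 <= a -> nrm (a *: u) = a * nrm u.
Proof.
move=> a0; rewrite /nrm dotZl dotZr mulrA -expr2 sqrtrM ?sqr_ge0//.
by rewrite sqrtr_sqr ger0_norm.
Qed.

Lemma nrmB u v : nrm (u - v) = nrm (v - u).
Proof. by rewrite -nrmN opprB. Qed.

Lemma abs_dot_le u v : `|dot u v| <= nrm u * nrm v.
Proof.
rewrite ler_norml dot_le_nrm andbT lerNl -dotNl -(nrmN u).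
exact: dot_le_nrm.
Qed.

Lemma nrm_one : nrm (l2one mu) = 1.
Proof.
rewrite /nrm /dot -[RHS]sqrtr1; congr Num.sqrt.
rewrite (@eq_Rintegral _ _ _ _ _ (cst 1)); last by move=> x _ /=; rewrite mulr1.
by rewrite Rintegral_cst//= probability_setT mul1r.
Qed.

Lemma dot_one : dot (l2one mu) (l2one mu) = 1.
Proof. by rewrite -nrm_sqr nrm_one expr1n. Qed.

(** Written as [u] minus its excess over [c], so that membership in L2 is inherited and [u] splits
    at once into a bounded part and an excess. *)
Definition trunc (c : R) u := u - vpos (u - c *: l2one mu).
Lemma truncE c u x : trunc c u x = Num.min (u x) c.
Proof.
by rewrite /trunc !l2E mulr1 /Num.max /Num.min subr_lt0; case: ltP; lra.
Qed.

Definition vabs u := vpos u + vpos (- u).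
Lemma vabsE u x : vabs u x = `|u x|.
Proof.
rewrite /vabs !l2E; have [h|h] := leP 0 (u x).
  by rewrite ger0_norm// (max_idPr _) ?oppr_le0// addr0.
by rewrite ltr0_norm// (max_idPl _) ?oppr_ge0 ?ltW// add0r.
Qed.

Lemma dot_vabs u : dot (vabs u) (vabs u) = dot u u.
Proof.
by apply: eq_Rintegral => x _; rewrite vabsE -expr2 real_normK ?num_real// expr2.
Qed.

Lemma integral_mulE u v : (\int[mu]_x (u x * v x)%:E)%E = (dot u v)%:E.
Proof.
rewrite /dot /Rintegral fineK//; apply: integrable_fin_num => //.
by apply: integrable_L2_mul; exact: l2P.
Qed.

Lemma measurable_l2 u : measurable_fun setT u. Proof. by have [] := l2P u. Qed.

Lemma dot_trunc_sup u (C : R) : (forall x, 0 <= u x) ->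
  (forall n, dot (trunc n%:R u) (trunc n%:R u) <= C) -> dot u u <= C.
Proof.
move=> u0 uC.
have [] := @dominated_convergence _ T R mu setT measurableT
  (fun n x => (trunc n%:R u x * trunc n%:R u x)%:E) (fun x => (u x * u x)%:E)
  (fun x => (u x * u x)%:E).
- by move=> n; apply/measurable_EFinP; apply: measurable_funM; exact: measurable_l2.
- by apply/measurable_EFinP; apply: measurable_funM; exact: measurable_l2.
- apply: aeW => x _; apply: cvg_near_cst; near=> n.
  have un : u x <= n%:R by near: n; exact: nbhs_infty_ger.
  by rewrite !truncE; congr (_ * _)%:E; exact/min_idPl.
- by apply: integrable_L2_mul; exact: l2P.
- apply: aeW => x n _; rewrite abse_EFin lee_fin truncE.
  rewrite ger0_norm -?expr2 ?sqr_ge0// ler_pXn2r// ?nnegrE ?le_min ?u0 ?ler0n//.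
  by rewrite ge_min lexx.
move=> _ _; rewrite integral_mulE => h.
rewrite -lee_fin; apply: (cvge_to_le h); apply: nearW => n.
by have := uC n; rewrite -lee_fin -integral_mulE.
Unshelve. all: by end_near. Qed.

End norm.

(** * Markov operators and their energy *)

Section markov.
Context {d : measure_display} {T : measurableType d} {R : realType}.
Variable mu : probability T R.
Local Notation V := (l2 mu).
Local Notation one := (l2one mu).
Implicit Types u v w : V.

Lemma l2_ext u v : (forall x, u x = v x) -> u = v.
Proof. by move=> uv; apply/val_inj/funext. Qed.

Lemma vpos_ge0 u x : 0 <= vpos u x.
Proof. by rewrite vposE le_max lexx orbT. Qed.

Lemma vpos_decomp u : u = vpos u - vpos (- u).
Proof.
apply: l2_ext => x; rewrite !l2E; have [h|h] := leP 0 (u x).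
  by rewrite (max_idPr _) ?oppr_le0// subr0.
by rewrite (max_idPl _) ?oppr_ge0 ?ltW// sub0r opprK.
Qed.

Lemma dot_vpos_vneg u : dot (vpos u) (vpos (- u)) = 0.
Proof.
rewrite -(dot0l (0 : V)); apply: eq_Rintegral => x _; rewrite !l2E mulr0.
have [h|h] := leP 0 (u x).
  by rewrite (max_idPr _) ?oppr_le0// mulr0.
by rewrite mul0r.
Qed.

Lemma dot_ge0_ptw u v : (forall x, 0 <= u x) -> (forall x, 0 <= v x) -> 0 <= dot u v.
Proof. by move=> u0 v0; apply: dot_ge0; exact: aeW. Qed.

Record Markov (M : V -> V) : Prop := {
  Markov_lin : forall a b u v, aeq mu (M (a *: u + b *: v)) (a *: M u + b *: M v);
  Markov_aeq : forall u v, aeq mu u v -> aeq mu (M u) (M v);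
  Markov_one : aeq mu (M one) one;
  Markov_ge0 : forall u, ale mu (cst 0) u -> ale mu (cst 0) (M u);
  Markov_inv : forall u, dot (M u) one = dot u one }.

Variable M : V -> V.
Hypothesis MM : Markov M.

Lemma dotM_lin a b u v w :
  dot (M (a *: u + b *: v)) w = a * dot (M u) w + b * dot (M v) w.
Proof. by rewrite (dot_aeq _ (Markov_lin MM a b u v)) !dotE. Qed.
Lemma dotMDl u v w : dot (M (u + v)) w = dot (M u) w + dot (M v) w.
Proof. by have := dotM_lin 1 1 u v w; rewrite !scale1r !mul1r. Qed.
Lemma dotMZl a u w : dot (M (a *: u)) w = a * dot (M u) w.
Proof. by have := dotM_lin a 0 u 0 w; rewrite scaler0 addr0 mul0r addr0. Qed.
Lemma dotMNl u w : dot (M (- u)) w = - dot (M u) w.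
Proof. by rewrite -scaleN1r dotMZl mulN1r. Qed.
Lemma dotMDr u v w : dot w (M (u + v)) = dot w (M u) + dot w (M v).
Proof. by rewrite dotC dotMDl !(dotC w). Qed.
Lemma dotMZr a u w : dot w (M (a *: u)) = a * dot w (M u).
Proof. by rewrite dotC dotMZl !(dotC w). Qed.
Lemma dotMNr u w : dot w (M (- u)) = - dot w (M u).
Proof. by rewrite dotC dotMNl !(dotC w). Qed.
Lemma dotM1l w : dot (M one) w = dot one w.
Proof. exact/dot_aeq/Markov_one. Qed.
Lemma dotM1r w : dot w (M one) = dot w one.
Proof. by rewrite dotC dotM1l dotC. Qed.

Definition dotME := (dotMDl, dotMDr, dotMNl, dotMNr, dotMZl, dotMZr, dotM1l, dotM1r).

Lemma nrmMB u v : nrm (M u - M v) = nrm (M (u - v)).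
Proof. by rewrite /nrm; congr Num.sqrt; rewrite !dotE !dotME; ring. Qed.

Lemma Markov_mono u v : ale mu u v -> ale mu (M u) (M v).
Proof.
move=> uv; have h : ale mu (cst 0) (v - u).
  by apply: filterS uv => x; rewrite l2D l2N /= subr_ge0.
have := Markov_ge0 MM h; have := Markov_lin MM 1 (-1) v u.
rewrite !scaleN1r !scale1r; apply: filterS2 => x; rewrite !l2E /= => ->.
by rewrite subr_ge0.
Qed.

Lemma Markov_le u v : (forall x, u x <= v x) -> ale mu (M u) (M v).
Proof. by move=> uv; apply: Markov_mono; exact: aeW. Qed.

(** This is Huber's function: [u ^ 2] up to height [n], then the tangent [2 n u - n ^ 2]. Its linear
    growth keeps it in the domain of [M], which [u ^ 2] may leave. *)
Lemma huber_subproof n u : (forall x, 0 <= u x) ->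
  L2 mu (fun x => 2 * (trunc n%:R u x * u x) - trunc n%:R u x ^+ 2).
Proof.
move=> u0; apply: (L2_le (g := (2 * n%:R) *: u)) (l2P _) _.
  by apply: measurable_funB; [apply: measurable_funM => //; apply: measurable_funM|apply: measurable_funX];
    exact: measurable_l2.
move=> x; rewrite l2Z truncE; have := u0 x; have n0 := ler0n R n.
move: (u x) n%:R n0 => y k k0 y0; rewrite [leRHS]ger0_norm ?mulr_ge0//.
have [h|h] := leP y k; rewrite ger0_norm; nra.
Qed.

(* Jensen's inequality for the linearly growing convex [phi], the supremum of the
   tangents [2 q y - q ^ 2] of [y ^ 2] over rational [0 <= q <= n]: a countable
   supremum, so that exceptional null sets can be discarded. *)
Lemma Markov_contraction_ge0 u : (forall x, 0 <= u x) ->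
  dot (M u) (M u) <= dot u u.
Proof.
move=> u0.
have Mu0 : ale mu (cst 0) (M u) by apply: (Markov_ge0 MM); exact: aeW.
have E : aeq mu (M u) (vpos (M u)).
  by apply: filterS Mu0 => x /= h; rewrite (max_idPl _).
rewrite (dot_aeq _ E) dotC (dot_aeq _ E).
apply: dot_trunc_sup => [x|n]; first exact: vpos_ge0.
pose phi := mkL2 (huber_subproof n u0).
have phiE x : phi x = 2 * (Num.min (u x) n%:R * u x) - Num.min (u x) n%:R ^+ 2.
  by rewrite -truncE.
have phiu : dot (M phi) one <= dot u u.
  rewrite (Markov_inv MM); apply: dot_le => x; rewrite l2oneE mulr1 phiE.
  have := sqr_ge0 (u x - Num.min (u x) n%:R); lra.
apply: le_trans phiu; apply: dot_ae.
(* An enumeration of the rationals; naturals coding none are sent to 0, which is itself an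
   admissible slope. *)
pose q (j : nat) : R := ratr (odflt 0%R (unpickle j) : rat).
have Q : {ae mu, forall x j, 0 <= q j <= n%:R ->
    2 * q j * M u x - q j ^+ 2 <= M phi x}.
  apply/ae_foralln => j.
  have [qn|qn] := boolP (0 <= q j <= n%:R); last by apply: aeW.
  have : ale mu (M ((2 * q j) *: u + (- (q j ^+ 2)) *: one)) (M phi).
    apply: Markov_le => x; rewrite !l2E phiE mulr1.
    have := u0 x; move/andP: qn => [q0 qn].
    have [h|h] := leP (u x) n%:R; first by have := sqr_ge0 (u x - q j); nra.
    nra.
  apply: filterS3 (Markov_lin MM (2 * q j) (- (q j ^+ 2)) u one) (Markov_one MM) => x.
  by rewrite !l2E /= => -> ->; rewrite mulr1.
apply: filterS2 Mu0 Q => x g0 Q.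
have {}g0 : 0 <= M u x := g0.
rewrite truncE vposE (max_idPl g0) mulr1.
set k := Num.min _ _; have k0 : 0 <= k by rewrite le_min g0 ler0n.
have kn : k <= n%:R by rewrite ge_min lexx orbT.
have kg : k <= M u x by rewrite ge_min lexx.
rewrite leNgt; apply/negP => hk.
have {}k0 : 0 < k.
  rewrite lt_neqAle k0 andbT; apply/eqP => k00; move: hk; rewrite -k00 mul0r.
  have := Q (pickle (0 : rat)); rewrite /q pickleK /= rmorph0 lexx ler0n => /(_ isT).
  lra.
(* At height [k] the tangent at [r] has the value [k ^ 2 - (k - r) ^ 2], and for [r] this close to
   [k] the loss [(k - r) ^ 2] is smaller than [k * k - M phi x]. *)
have [r] : exists r : rat, ratr r \in `]Num.max 0 (k - (k * k - M phi x) / (2 * k)), k[%R.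
  apply: rat_in_itvoo; rewrite gt_max k0 ltrBlDr ltrDl divr_gt0 ?subr_gt0//.
  by rewrite mulr_gt0.
rewrite in_itv/= gt_max => /andP[/andP[r0 rk] rk'].
have := Q (pickle r); rewrite /q pickleK /= (ltW r0) (le_trans (ltW rk') kn) => /(_ isT).
move: rk; rewrite ltrBlDr -ltrBlDl ltr_pdivlMr ?mulr_gt0//.
nra.
Qed.

Lemma Markov_norm_le u : ale mu (vabs (M u)) (M (vabs u)).
Proof.
have h1 : ale mu (M u) (M (vabs u)).
  by apply: Markov_le => x; rewrite vabsE ler_norm.
have h2 : ale mu (M (- u)) (M (vabs u)).
  by apply: Markov_le => x; rewrite vabsE -normrN ler_norm.
have := Markov_lin MM (-1) 0 u 0; rewrite scaler0 addr0 scale0r addr0 !scaleN1r.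
apply: filterS3 h1 h2 => x h1 h2; rewrite l2N => h3.
by rewrite vabsE ler_norml h1 andbT lerNl -h3.
Qed.

Lemma Markov_contraction u : dot (M u) (M u) <= dot u u.
Proof.
rewrite -(dot_vabs u) -(dot_vabs (M u)).
apply: le_trans (Markov_contraction_ge0 _); last by move=> x; rewrite vabsE.
apply: dot_ae; apply: filterS (Markov_norm_le u) => x h.
by apply: ler_pM => //; rewrite vabsE.
Qed.

Lemma nrmM u : nrm (M u) <= nrm u.
Proof. by rewrite nrm_le ?nrm_ge0// nrm_sqr Markov_contraction. Qed.

Definition energy u := dot u u - dot u (M u).

Lemma energy_ge0 u : 0 <= energy u.
Proof.
rewrite subr_ge0 (le_trans (dot_le_nrm _ _))// -nrm_sqr expr2.
by rewrite ler_wpM2l ?nrm_ge0 ?nrmM.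
Qed.

(** Expand the square and use that [M] is a contraction. Small energy thus means almost fixed, even
    when [M] is not symmetric. *)
Lemma nrmBM_energy u : nrm (M u - u) ^+ 2 <= 2 * energy u.
Proof.
rewrite nrm_sqr /energy !dotE (dotC (M u) u).
have := Markov_contraction u; lra.
Qed.

Lemma dotM_ge0 u v : (forall x, 0 <= u x) -> (forall x, 0 <= v x) -> 0 <= dot u (M v).
Proof. by move=> u0 v0; apply: dot_ge0; [|apply: (Markov_ge0 MM)]; exact: aeW. Qed.

Lemma energyZ a u : energy (a *: u) = a ^+ 2 * energy u.
Proof. by rewrite /energy !dotE !dotME; ring. Qed.

Lemma energyN u : energy (- u) = energy u.
Proof. by rewrite /energy !dotE !dotME; ring. Qed.

Lemma energyDc u c : energy (u + c *: one) = energy u.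
Proof.
by rewrite /energy !dotE !dotME (dotC one (M u)) (Markov_inv MM) (dotC one u); ring.
Qed.

(** With [p] and [q] the positive and negative parts of [u], orthogonality gives
    [E u = E p + E q + <p, M q> + <q, M p>], and every term is nonnegative. *)
Lemma energy_vpos u : energy (vpos u) <= energy u.
Proof.
rewrite [in leRHS](vpos_decomp u).
have := dotM_ge0 (vpos_ge0 u) (vpos_ge0 (- u)).
have := dotM_ge0 (vpos_ge0 (- u)) (vpos_ge0 u).
have := energy_ge0 (vpos (- u)).
rewrite /energy !dotE !dotME (dotC (vpos (- u)) (vpos u)) dot_vpos_vneg.
lra.
Qed.

Lemma energy_trunc c u : energy (trunc c u) <= energy u.
Proof.
have -> : trunc c u = - vpos (- u + c *: one) + c *: one.
  by apply: l2_ext => x; rewrite truncE !l2E mulr1 /Num.max /Num.min; case: ltP => ?; case: ltP => ?; lra.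
by rewrite energyDc energyN (le_trans (energy_vpos _))// energyDc energyN.
Qed.

(** [u - vpos (u - v)] is the minimum of [u] and [v]. Energy is submodular: with [p], [q] the parts
    of [u - v], the sum [E u + E v] exceeds [E (min) + E (max)] by [<p, M q> + <q, M p>], and the
    energy of the maximum [v + p] is nonnegative. *)
Lemma energy_min u v : energy (u - vpos (u - v)) <= energy u + energy v.
Proof.
have [w wE] : exists w, w = u - v by exists (u - v).
have uE : u = v + (vpos w - vpos (- w)) by rewrite -vpos_decomp wE addrC subrK.
rewrite -wE uE.
have := energy_ge0 (v + vpos w).
have := dotM_ge0 (vpos_ge0 w) (vpos_ge0 (- w)).
have := dotM_ge0 (vpos_ge0 (- w)) (vpos_ge0 w).
have := dot_vpos_vneg w.
move: (vpos w) (vpos (- w)) => p q.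
rewrite /energy !dotE !dotME (dotC q p) (dotC p v) (dotC q v) => ->.
lra.
Qed.

End markov.

(** * The mean ergodic theorem and asymptotic independence *)

Section completeness.
Context {d : measure_display} {T : measurableType d} {R : realType}.
Variable mu : probability T R.
Local Notation V := (l2 mu).
Local Notation one := (l2one mu).
Implicit Types v w : V.

Lemma dot_vabs_one_le v : dot (vabs v) one <= nrm v.
Proof.
by rewrite (le_trans (dot_le_nrm _ _))// nrm_one mulr1 /nrm dot_vabs.
Qed.

(** The Riesz-Fischer argument: the L1 norms of the increments have sum at most 2, so the series of
    their absolute values is finite almost everywhere. *)
Lemma ae_cvg_of_summable (u : nat -> V) :
  (forall k, nrm (u k.+1 - u k) <= 2^-1 ^+ k) ->
  {ae mu, forall x, cvgn (fun k => u k x)}.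
Proof.
move=> hu; pose D k x : \bar R := (`|u k.+1 x - u k x|)%:E.
have mD k : measurable_fun setT (D k).
  apply/measurable_EFinP; apply: measurableT_comp => //.
  by apply: measurable_funB; exact: measurable_l2.
have D0 k x : (0 <= D k x)%E by rewrite lee_fin.
have sD : (\int[mu]_x (\sum_(k <oo) D k x) <= 2%:E)%E.
  rewrite integral_nneseries//; apply: lime_le.
    by apply: is_cvg_nneseries => k _ _; exact: integral_ge0.
  apply: nearW => n.
  have -> : \sum_(0 <= k < n) (\int[mu]_x D k x)%E =
      (\sum_(0 <= k < n) (dot (vabs (u k.+1 - u k)) one))%:E.
    rewrite -sumEFin; apply: eq_bigr => k _; rewrite -integral_mulE.
    by apply: eq_integral => x _; rewrite vabsE mulr1.
  rewrite lee_fin; have := @geometric_le_lim R n 1 2^-1.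
  have -> : 1 * (1 - 2^-1)^-1 = 2 :> R by field.
  have h1 : 2^-1 < 1 :> R by rewrite invf_lt1// ltr1n.
  have h0 : 0 < 2^-1 :> R by rewrite invr_gt0.
  rewrite gtr0_norm// => /(_ ler01 h0 h1)/(le_trans _); apply.
  rewrite /series/= ler_sum// => k _.
  by rewrite mul1r (le_trans (dot_vabs_one_le _)).
have mS : measurable_fun setT (fun x => \sum_(k <oo) D k x)%E.
  exact: ge0_emeasurable_sum.
have : mu.-integrable setT (fun x => \sum_(k <oo) D k x)%E.
  apply/integrableP; split => //.
  rewrite (eq_integral (fun x => \sum_(k <oo) D k x)%E); last first.
    by move=> x _; rewrite gee0_abs// nneseries_ge0.
  by rewrite (le_lt_trans sD)// ltry.
move/(integrable_ae measurableT); apply: filterS => x /(_ I) fx.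
have : cvgn (series (telescope (fun k => u k x))).
  apply: normed_cvg; apply: nondecreasing_is_cvgn.
    by have := @nondecreasing_series R (fun k => `|telescope (fun k => u k x) k|) xpredT 0; apply.
  exists (fine (\sum_(k <oo) D k x)%E) => _ [n _ <-].
  rewrite -lee_fin fineK//.
  have := @nneseries_lim_ge R (D ^~ x) xpredT 0 n (fun k _ _ => D0 k x).
  by rewrite /D sumEFin.
move=> c; have -> : (fun k => u k x) = (fun k => series (telescope (fun k => u k x)) k + u 0 x).
  by apply/funext => k; rewrite [u k x](eq_sum_telescope (fun k => u k x)) addrC.
by apply: is_cvgD => //; exact: is_cvg_cst.
Qed.

Lemma bounded_complete (u : nat -> V) :
  (forall k, {ae mu, forall x, 0 <= u k x <= 1}) ->
  (forall k, nrm (u k.+1 - u k) <= 2^-1 ^+ k) ->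
  exists v, forall e, 0 < e -> exists N, forall k, (N <= k)%N -> nrm (u k - v) <= e.
Proof.
move=> u01 hu.
(* The upper limit is measurable whether or not the sequence converges at [x]; clamping it to
   [[0, 1]] puts it in L2 and changes nothing almost everywhere. *)
pose f x := Num.max 0 (Num.min 1 (fine (limn_esup (fun k => (u k x)%:E)))).
have Lf : L2 mu f.
  apply: L2_le (L2_cst mu 1) _.
    apply: measurable_maxr => //; apply: measurable_minr => //.
    apply: measurableT_comp => //; apply: measurable_fun_limn_esup => k.
    by apply/measurable_EFinP; exact: measurable_l2.
  by move=> x /=; rewrite ger0_norm ?le_max ?lexx// normr1 ge_max ler01 ge_min lexx.
pose v := mkL2 Lf; exists v.
have v01 x : 0 <= v x <= 1.
  by rewrite /= /f le_max lexx ge_max ler01 ge_min lexx.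
have uv : {ae mu, forall x, (fun k => u k x) @ \oo --> v x}.
  apply: filterS2 (ae_cvg_of_summable hu) (ae_foralln u01) => x cu ux.
  have cl : (fun k => (u k x)%:E) @ \oo --> (limn (fun k => u k x))%:E.
    by apply: cvg_EFin => //; exact: nearW.
  rewrite /v/= /f is_cvg_limn_esupE; last by apply/cvg_ex; exists (limn (fun k => u k x))%:E.
  rewrite (cvg_lim _ cl)//= (min_idPr _) ?(max_idPr _)//.
    by apply: limr_ge => //; apply: nearW => k; have /andP[] := ux k.
  by apply: limr_le => //; apply: nearW => k; have /andP[] := ux k.
have [] := @dominated_convergence _ T R mu setT measurableT
  (fun k x => ((u k - v) x * (u k - v) x)%:E) (cst 0%E) (cst 1%E).
- by move=> n; apply/measurable_EFinP; apply: measurable_funM; exact: measurable_l2.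
- exact: measurable_cst.
- apply: filterS uv => x ux _; apply: cvg_EFin; first exact: nearW.
  rewrite -[0](mulr0 0); under eq_fun do rewrite l2D l2N.
  by apply: cvgM; rewrite -(subrr (v x)); apply: cvgB => //; exact: cvg_cst.
- exact: (@finite_measure_integrable_cst _ _ _ mu _ 1 measurableT).
- apply: filterS (ae_foralln u01) => x ux n _.
  rewrite abse_EFin lee_fin -expr2 ger0_norm ?sqr_ge0// l2D l2N.
  have := ux n; have := v01 x; move: (u n x) (v x) => a b; nra.
move=> _ _; rewrite integral_cst// mul0e => /fine_cvgP[_ cv] e e0.
have /cvgrPdist_le /(_ (e ^+ 2)) := cv; rewrite exprn_gt0// => /(_ isT)[N _ hN].
exists N => k Nk; rewrite nrm_le ?(ltW e0)//; have := hN k Nk.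
rewrite sub0r normrN; apply: le_trans; exact: ler_norm.
Qed.

End completeness.

Section ergodic.
Context {d : measure_display} {T : measurableType d} {R : realType}.
Variable mu : probability T R.
Local Notation V := (l2 mu).
Local Notation one := (l2one mu).
Implicit Types u v w : V.

Lemma aeq_trans u v w : aeq mu u v -> aeq mu v w -> aeq mu u w.
Proof. by apply: filterS2 => x -> ->. Qed.

Lemma nrm_aeq u v : aeq mu u v -> nrm u = nrm v.
Proof. by move=> uv; rewrite /nrm (dot_aeq _ uv) dotC (dot_aeq _ uv). Qed.

Lemma nrm_le0 u : nrm u <= 0 -> aeq mu u 0.
Proof.
by rewrite nrm_le// expr0n/= => u0; apply: dot_eq0; apply/eqP; rewrite eq_le u0 dot_sqr_ge0.
Qed.

Lemma aeq_nrmB u v : nrm (u - v) <= 0 -> aeq mu u v.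
Proof.
by move/nrm_le0; apply: filterS => x h; exact: subr0_eq h.
Qed.

Lemma nrm_le1 u : (forall x, 0 <= u x <= 1) -> nrm u <= 1.
Proof.
move=> u01; rewrite nrm_le// expr1n -(@dot_one _ _ _ mu); apply: dot_le => x.
rewrite l2oneE; have := u01 x; nra.
Qed.

Lemma Markov_id : Markov (@id V).
Proof. by split => // *; exact: aeW. Qed.

Lemma Markov_comp (M N : V -> V) : Markov M -> Markov N -> Markov (M \o N).
Proof.
move=> MM MN; split => /=.
- move=> a b u v.
  exact: aeq_trans (Markov_aeq MM (Markov_lin MN a b u v)) (Markov_lin MM a b _ _).
- by move=> u v uv; apply: (Markov_aeq MM); exact: Markov_aeq.
- exact: aeq_trans (Markov_aeq MM (Markov_one MN)) (Markov_one MM).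
- by move=> u u0; apply: (Markov_ge0 MM); exact: (Markov_ge0 MN).
- by move=> u; rewrite (Markov_inv MM) (Markov_inv MN).
Qed.

Lemma Markov_iter (M : V -> V) n : Markov M -> Markov (iter n M).
Proof.
by move=> MM; elim: n => [|n IH]; [exact: Markov_id|exact: Markov_comp MM IH].
Qed.

Definition average (M N : V -> V) u := 2^-1 *: (M u + N u).

Lemma Markov_average (M N : V -> V) : Markov M -> Markov N -> Markov (average M N).
Proof.
move=> MM MN; split.
- move=> a b u v; apply: filterS2 (Markov_lin MM a b u v) (Markov_lin MN a b u v) => x.
  rewrite /average !l2Z !l2D => -> ->; rewrite !l2Z !l2D; ring.
- move=> u v uv; apply: filterS2 (Markov_aeq MM uv) (Markov_aeq MN uv) => x.
  by rewrite !l2Z !l2D => -> ->.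
- apply: filterS2 (Markov_one MM) (Markov_one MN) => x.
  by rewrite !l2Z !l2D => -> ->; rewrite l2oneE; field.
- move=> u u0; apply: filterS2 (Markov_ge0 MM u0) (Markov_ge0 MN u0) => x h1 h2.
  by rewrite l2Z l2D; apply: mulr_ge0; [rewrite invr_ge0|exact: addr_ge0].
- by move=> u; rewrite dotZl dotDl (Markov_inv MM) (Markov_inv MN); field.
Qed.

(** Each property of [N] comes from one of [M]: [N 1 = 1] from invariance, invariance from
    [M 1 = 1]. For positivity, test [N u] against its own negative part [z]: the result is
    [- <z, z>], but also [<u, M z> >= 0]. *)
Lemma Markov_adjoint (M N : V -> V) : Markov M ->
  (forall a b u v, aeq mu (N (a *: u + b *: v)) (a *: N u + b *: N v)) ->
  (forall u v, aeq mu u v -> aeq mu (N u) (N v)) ->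
  (forall u v, dot v (M u) = dot (N v) u) -> Markov N.
Proof.
move=> MM Nlin Naeq adj; split => //.
- apply/aeq_nrmB; rewrite nrm_le// dotBl -adj dotC (Markov_inv MM) (dotC one).
  by rewrite subrr expr0n.
- move=> u u0; have h : dot (N u) (vpos (- N u)) = - dot (vpos (- N u)) (vpos (- N u)).
    have := dotBl (vpos (N u)) (vpos (- N u)) (vpos (- N u)).
    by rewrite -vpos_decomp dot_vpos_vneg sub0r.
  have : 0 <= dot (N u) (vpos (- N u)).
    rewrite -adj dot_ge0//; apply: (Markov_ge0 MM); apply: aeW => x; exact: vpos_ge0.
  rewrite h oppr_ge0 => h0.
  have : aeq mu (vpos (- N u)) (cst 0) by apply: dot_eq0; apply/eqP; rewrite eq_le h0 dot_sqr_ge0.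
  apply: filterS => x px; have {}px : Num.max (- N u x) 0 = 0 := px.
  by rewrite /= -oppr_le0 -px le_max lexx.
- by move=> u; rewrite -adj (dotM1r MM).
Qed.

Lemma iter_nrm_le (M : V -> V) u n : Markov M ->
  nrm (iter n M u - u) <= n%:R * nrm (M u - u).
Proof.
move=> MM; elim: n => [|n IH] /=; first by rewrite subrr mul0r /nrm dot0l sqrtr0.
have -> : M (iter n M u) - u = (M (iter n M u) - M u) + (M u - u) by rewrite addrA subrK.
rewrite (le_trans (nrmD _ _))// (nrmMB MM) -natr1 mulrDl mul1r lerD2r.
exact: le_trans (nrmM MM _) IH.
Qed.

Lemma exists_exp_le (q e : R) : 0 <= q < 1 -> 0 < e -> exists k, q ^+ k <= e.
Proof.
move=> /andP[q0 q1] e0; have := @cvg_geometric R 1 q.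
rewrite ger0_norm// => /(_ q1)/cvgrPdist_le/(_ _ e0)[k _ /(_ k)].
rewrite /= leqnn mul1r sub0r normrN => /(_ isT) h; exists k.
by rewrite (le_trans (ler_norm _)).
Qed.

Lemma le0_of_le_pos (x : R) : (forall e, 0 < e -> x <= e) -> x <= 0.
Proof.
move=> h; rewrite leNgt; apply/negP => x0.
by have := h (x / 2); rewrite divr_gt0// => /(_ isT); lra.
Qed.

Section mean_ergodic.
Variable Q : V -> V.
Hypotheses (MQ : Markov Q) (symQ : forall u v, dot (Q u) v = dot u (Q v)).

Lemma dot_iter_sym u v i j : dot (iter i Q u) (iter j Q v) = dot u (iter (i + j) Q v).
Proof. by elim: i j => [//|i IH] j; rewrite iterS symQ -iterS IH addnS. Qed.

(* [|Q^(2n) u - Q^(2m) u|^2 = b (2n) + b (2m) - 2 b (n + m)] where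
   [b n = |Q^n u|^2] decreases, hence converges. *)
Lemma iter_sym_cauchy u e : 0 < e -> exists N, forall n m, (N <= n)%N -> (N <= m)%N ->
  nrm (iter n.*2 Q u - iter m.*2 Q u) <= e.
Proof.
move=> e0; pose b n := dot (iter n Q u) (iter n Q u).
have bS n : b n.+1 <= b n by exact: (Markov_contraction MQ).
have b_le n m : (n <= m)%N -> b m <= b n.
  by move=> /subnK <-; elim: (m - n)%N => [//|k IH]; rewrite addSn (le_trans (bS _)).
have hb : has_inf (range b).
  by split; [exists (b 0), 0%N|exists 0 => _ [n _ <-]; exact: dot_sqr_ge0].
have [_ [N _ <-] bN] := inf_adherent (divr_gt0 (exprn_gt0 2 e0) (ltr0Sn R 1)) hb.
exists N => n m Nn Nm; rewrite nrm_le ?ltW// !dotE !dot_iter_sym.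
have binf k : inf (range b) <= b k by apply: ge_inf; [case: hb|exists k].
have bE k : dot u (iter k.*2 Q u) = b k by rewrite -addnn -dot_iter_sym.
rewrite -!doubleD !bE (addnC m n).
have Nn2 : b n.*2 <= b N by apply: b_le; rewrite (leq_trans Nn)// -addnn leq_addr.
have Nm2 : b m.*2 <= b N by apply: b_le; rewrite (leq_trans Nm)// -addnn leq_addr.
rewrite !addnn.
have := binf (n + m)%N; move: bN; lra.
Qed.

(** A fast subsequence of the even iterates converges; its limit is fixed by the square of [Q],
    hence constant, and invariance of the mean identifies the constant. The fixed-point hypothesis
    concerns [Q (Q u)] because only even iterates are known to be Cauchy. *)
Lemma mean_ergodic (chi : V) e : (forall x, 0 <= chi x <= 1) ->
  (forall u, aeq mu (Q (Q u)) u -> exists c, aeq mu u (c *: one)) ->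
  0 < e -> exists n, nrm (iter n Q chi - dot chi one *: one) <= e.
Proof.
move=> chi01 fixQ e0.
have half_gt0 k : 0 < 2^-1 ^+ k :> R by rewrite exprn_gt0// invr_gt0.
have [N hN] := choice (fun k => iter_sym_cauchy chi (half_gt0 k)).
(* Partial sums make the indices nondecreasing while keeping [N k <= n k]. *)
pose n k := (\sum_(i < k.+1) N i)%N.
have Nn k : (N k <= n k)%N by rewrite /n big_ord_recr leq_addl.
have nS k : (n k <= n k.+1)%N by rewrite /n [leqRHS]big_ord_recr leq_addr.
pose u k := iter (n k).*2 Q chi.
have u01 k : {ae mu, forall x, 0 <= u k x <= 1}.
  have MQk := Markov_iter (n k).*2 MQ.
  have h0 : ale mu (cst 0) (u k).
    by apply: (Markov_ge0 MQk); apply: aeW => x; have /andP[] := chi01 x.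
  have h1 : ale mu (u k) (iter (n k).*2 Q one).
    by apply: (Markov_le MQk) => x; rewrite l2oneE; have /andP[] := chi01 x.
  apply: filterS3 h0 h1 (Markov_one MQk) => x /= -> + E.
  by rewrite E.
have uS k : nrm (u k.+1 - u k) <= 2^-1 ^+ k by apply: hN => //; exact: leq_trans (nS k).
have [v hv] := bounded_complete u01 uS.
have QB a b : nrm (Q (Q a) - Q (Q b)) <= nrm (a - b).
  rewrite (nrmMB MQ) (le_trans (nrmM MQ _))// (nrmMB MQ); exact: nrmM.
have vfix : aeq mu (Q (Q v)) v.
  apply: aeq_nrmB; apply: le0_of_le_pos => r r0.
  have r3 : 0 < r / 3 by rewrite divr_gt0.
  have [K hK] := hv _ r3; have [j hj] : exists j, 2^-1 ^+ j <= r / 3.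
    by apply: exists_exp_le => //; rewrite invr_ge0 ler0n invf_lt1// ltr1n.
  pose k := maxn K j.
  have uv := hK k (leq_maxl _ _).
  have QQu : nrm (Q (Q (u k)) - u k) <= r / 3.
    have := hN k (n k).+1 (n k) (leqW (Nn k)) (Nn k).
    rewrite doubleS !iterS => /le_trans; apply; apply: le_trans hj.
    by rewrite ler_wiXn2l ?leq_maxr// ?invr_ge0// invf_le1// ler1n.
  have -> : Q (Q v) - v = (Q (Q v) - Q (Q (u k))) + ((Q (Q (u k)) - u k) + (u k - v)).
    by rewrite !addrA !subrK.
  rewrite (le_trans (nrmD _ _))//.
  have := nrmD (Q (Q (u k)) - u k) (u k - v).
  have := QB v (u k); rewrite (nrmB v); lra.
have [c vc] := fixQ v vfix.
have dv : dot v one = c by rewrite (dot_aeq _ vc) dotZl dot_one mulr1.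
have du k : dot (u k) one = dot chi one by exact: (Markov_inv (Markov_iter _ MQ)).
have {}dv : dot chi one = c.
  apply/eqP; rewrite -subr_eq0 -normr_le0; apply: le0_of_le_pos => r r0.
  have [K /(_ K (leqnn _)) hK] := hv r r0; apply: le_trans hK.
  by rewrite -(du K) -dv -dotBl (le_trans (abs_dot_le _ _))// nrm_one mulr1.
have [K /(_ K (leqnn _)) hK] := hv e e0; exists (n K).*2.
rewrite dv; apply: le_trans hK; rewrite le_eqVlt; apply/orP; left; apply/eqP.
by apply: nrm_aeq; apply: filterS vc => x h; rewrite !l2D !l2N h.
Qed.

End mean_ergodic.

Section mixing.
Variables P Ps : V -> V.
Hypotheses (MP : Markov P) (MPs : Markov Ps).
Hypothesis adj : forall u v, dot v (P u) = dot (Ps v) u.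
Hypothesis ergP : forall u, aeq mu (P u) u -> exists c, aeq mu u (c *: one).

Let H := average P Ps.
Let MH : Markov H. Proof. exact: Markov_average. Qed.

Lemma average_sym u v : dot (H u) v = dot u (H v).
Proof.
rewrite !dotE -adj (dotC u (Ps v)) -adj (dotC (P u)); ring.
Qed.

Lemma energy_average u : energy H u = energy P u.
Proof. by rewrite /energy !dotE (dotC u (Ps u)) -adj; field. Qed.

Lemma energy_le0_const u : energy P u <= 0 -> exists c, aeq mu u (c *: one).
Proof.
move=> E0; apply: ergP; apply: aeq_nrmB.
rewrite nrm_le// expr0n -nrm_sqr (le_trans (nrmBM_energy MP u))//.
by rewrite pmulr_rle0.
Qed.

(** Transfer iterates of a symmetric [Q] from [w], which they barely move, to [chi], which they make
    almost constant: [<chi, w>] is close to [<chi, Q^n w> = <Q^n chi, w>], hence to the product of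
    the means. As [n] depends on [chi] and [e] only, [r] is uniform in [w]. *)
Lemma mixing (chi : V) e : (forall x, 0 <= chi x <= 1) -> 0 < e ->
  exists2 r, 0 < r & forall w, (forall x, 0 <= w x <= 1) -> energy P w <= r ->
    `|dot chi w - dot chi one * dot w one| <= e.
Proof.
(* The lazy version of [H] excludes the eigenvalue [-1]: if its square fixes [u], then
   [|Q u| = |u|], which forces [<u, H u> >= <u, u>]. *)
move=> chi01 e0; pose Q := average (@id V) H.
have MQ : Markov Q by apply: Markov_average => //; exact: Markov_id.
have symQ u v : dot (Q u) v = dot u (Q v).
  by rewrite [LHS]dotZl [RHS]dotZr dotDl dotDr average_sym.
have fixQ u : aeq mu (Q (Q u)) u -> exists c, aeq mu u (c *: one).
  move=> Qu; apply: energy_le0_const; rewrite -energy_average /energy.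
  have := dot_aeq u Qu; rewrite symQ.
  have := Markov_contraction MH u.
  rewrite [dot (Q u) _]dotZl [dot _ (Q u)]dotZr dotDl !dotDr (dotC (H u) u); lra.
have e2 : 0 < e / 2 by rewrite divr_gt0.
have [n hn] := mean_ergodic MQ symQ chi01 fixQ e2.
(* Each of the [n] iterations moves [w] by at most [rho], in total by at most [e / 2]; the successor
   avoids dividing by 0. *)
pose rho := e / (2 * n.+1%:R).
have rho0 : 0 < rho by rewrite divr_gt0// mulr_gt0.
exists (rho ^+ 2 / 2) => [|w w01 Ew]; first by rewrite divr_gt0 ?exprn_gt0.
have Qw : nrm (Q w - w) <= rho.
  have -> : Q w - w = 2^-1 *: (H w - w).
    by apply: l2_ext => x; rewrite !l2E; field.
  rewrite nrmZ ?invr_ge0//.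
  have : nrm (H w - w) <= rho.
    have := nrmBM_energy MH w; rewrite energy_average nrm_sqr nrm_le ?(ltW rho0)//.
    move: Ew; lra.
  have := nrm_ge0 (H w - w); lra.
have Qnw : nrm (iter n Q w - w) <= e / 2.
  rewrite (le_trans (iter_nrm_le _ _ MQ))//.
  apply: (@le_trans _ _ (n.+1%:R * rho)).
    by apply: ler_pM => //; rewrite ?nrm_ge0 ?ler_nat.
  by rewrite /rho le_eqVlt; apply/orP; left; apply/eqP; field.
have -> : dot chi w - dot chi one * dot w one =
    dot (iter n Q chi - dot chi one *: one) w - dot chi (iter n Q w - w).
  have := dot_iter_sym symQ chi w n 0; rewrite addn0 /= => h.
  rewrite !dotE h (dotC one w); ring.
rewrite (le_trans (ler_normB _ _))// [leRHS](splitr e) lerD//.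
  rewrite (le_trans (abs_dot_le _ _))// (le_trans _ hn)// ler_piMr ?nrm_ge0//.
  exact: nrm_le1.
rewrite (le_trans (abs_dot_le _ _))// (le_trans _ Qnw)// ler_piMl ?nrm_ge0//.
exact: nrm_le1.
Qed.

End mixing.
End ergodic.

(** * Concentration without a spectral gap *)

Section concentration.
Context {d : measure_display} {T : measurableType d} {R : realType}.
Variable mu : probability T R.
Local Notation V := (l2 mu).
Local Notation one := (l2one mu).
Implicit Types u v w : V.

Variables P Ps : V -> V.
Hypotheses (MP : Markov P) (MPs : Markov Ps).
Hypothesis adj : forall u v, dot v (P u) = dot (Ps v) u.
Hypothesis ergP : forall u, aeq mu (P u) u -> exists c, aeq mu u (c *: one).

(* [chi] dominates the indicator of the support of [u]. *)
Definition supp_le u (chi : V) :=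
  (forall x, 0 <= chi x <= 1) /\ (forall x, u x = 0 \/ chi x = 1).

Definition concentrated (s e : R) u :=
  [/\ forall x, 0 <= u x, (exists2 chi, supp_le u chi & dot chi one <= s),
      0 < dot u u & energy P u <= e * dot u u].

(** The bounds [c] and [q] are uniform in [e]. The function [v] stands in for the indicator of the
    support of [w], which would come with no energy bound and so could not be used in [mixing]. *)
Definition near_invariant_pairs (c q : R) := forall e, 0 < e -> exists w v : V,
  [/\ (forall x, 0 <= w x <= 1), supp_le w v,
      energy P w <= e /\ energy P v <= e, c <= dot w one & dot v one <= 1 - q].

Lemma dot_sqrD_le u v : dot (u + v) (u + v) <= 2 * dot u u + 2 * dot v v.
Proof. have := dot_sqr_ge0 (u - v); rewrite !dotE (dotC v u); lra. Qed.

Lemma energy_one : energy P one = 0.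
Proof. by rewrite /energy (dotM1r MP) subrr. Qed.

Lemma dot_one_ge0 v : (forall x, 0 <= v x <= 1) -> 0 <= dot v one.
Proof.
by move=> v01; apply: dot_ge0_ptw => x; rewrite ?l2oneE//; have /andP[] := v01 x.
Qed.

(* Near-invariant functions are asymptotically independent by [mixing], so
   intersecting one more pair multiplies the support by at most [1 - q / 2]. *)
Lemma shrink_support (c q : R) n : 0 < c -> 0 < q -> near_invariant_pairs c q ->
  exists2 del, 0 < del & forall e, 0 < e -> exists b chi : V,
    [/\ (forall x, 0 <= b x <= 1), supp_le b chi, energy P b <= e,
        del <= dot b one & dot chi one <= (1 - q / 2) ^+ n].
Proof.
move=> c0 q0 wv.
have q1 : q <= 1.
  by have [w [v [_ [/dot_one_ge0 v0 _] _ _]]] := wv 1 ltr01; lra.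
have r0 : 0 < 1 - q / 2 by lra.
elim: n => [|n [del del0 IH]].
  exists 1 => // e e0; exists one, one; split => //.
  - by move=> x; rewrite l2oneE ler01 lexx.
  - by split=> x; [rewrite l2oneE ler01 lexx|right].
  - by rewrite energy_one ltW.
  - by rewrite dot_one.
  - by rewrite dot_one expr0.
exists (del * c / 2) => [|e e0]; first by rewrite divr_gt0 ?mulr_gt0.
have e2 : 0 < e / 2 by rewrite divr_gt0.
have [b [chi [b01 [chi01 bchi] Eb delb chin]]] := IH _ e2.
have eta1_gt0 : 0 < del * c / 2 by rewrite divr_gt0 ?mulr_gt0.
(* The gap between [(1 - q / 2) ^ n * (1 - q)] and [(1 - q / 2) ^ n.+1]. The mixing thresholds below
   depend on [b] and [chi], so the new pair is chosen after them. *)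
have eta2_gt0 : 0 < q / 2 * (1 - q / 2) ^+ n by rewrite mulr_gt0 ?exprn_gt0 ?divr_gt0.
have [r1 r1_gt0 mixb] := mixing MP MPs adj ergP b01 eta1_gt0.
have [r2 r2_gt0 mixchi] := mixing MP MPs adj ergP chi01 eta2_gt0.
have rr : 0 < Num.min (e / 2) (Num.min r1 r2) by rewrite !lt_min e2 r1_gt0.
have [w [v [w01 [v01 wv1] [Ew Ev] cw vq]]] := wv _ rr.
move: Ew Ev; rewrite !le_min => /and3P[Ew Ew1 _] /and3P[_ _ Ev2].
(* The minimum of [b] and [w] dominates [b * w]; the second witness lies below [chi * v] and is 1
   wherever both [chi] and [v] are. So [mixing] bounds the first mean from below and the second from
   above. *)
exists (b - vpos (b - w)), (vpos (chi + v - one)); split.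
- move=> x; rewrite !l2E; have := b01 x; have := w01 x.
  by rewrite /Num.max; case: ltP; lra.
- split=> x; rewrite !l2E.
    by have := chi01 x; have := v01 x; rewrite /Num.max; case: ltP; lra.
  have [bx|->] := bchi x.
    by left; rewrite bx /Num.max; have := w01 x; case: ltP; lra.
  have [wx|->] := wv1 x.
    by left; rewrite wx /Num.max; have := b01 x; case: ltP; lra.
  by right; rewrite addrK /Num.max ltr10.
- by rewrite (le_trans (energy_min MP _ _))// [leRHS]splitr lerD.
- apply: (@le_trans _ _ (dot b w)); last first.
    apply: dot_le => x; rewrite !l2E; have := b01 x; have := w01 x.
    rewrite /Num.max; case: ltP => ? ? ?; nra.
  have := mixb w w01 Ew1; rewrite ler_norml => /andP[+ _].
  have : del * c <= dot b one * dot w one by apply: ler_pM => //; exact: ltW.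
  lra.
- apply: (@le_trans _ _ (dot chi v)).
    apply: dot_le => x; rewrite !l2E; have := chi01 x; have := v01 x.
    rewrite /Num.max; case: ltP => ? ? ?; nra.
  have := mixchi v v01 Ev2; rewrite ler_norml => /andP[_].
  have : dot chi one * dot v one <= (1 - q / 2) ^+ n * (1 - q).
    by apply: ler_pM => //; exact: dot_one_ge0.
  rewrite exprS; lra.
Qed.

(** The excess of the positive part [h] over [K] is supported where [h > K], so without concentrated
    functions it carries little of the square. The truncation [k] therefore keeps a definite mean;
    rescaling [k] and cutting at level [t] yields the pair. *)
Lemma nearly_invariant_pairs_of (s e : R) : 0 < s -> 0 < e ->
  (forall u, ~ concentrated s e u) ->
  (forall r, 0 < r -> exists f, [/\ dot f one = 0, dot f f = 1 & energy P f <= r]) ->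
  exists c q, [/\ 0 < c, 0 < q & near_invariant_pairs c q].
Proof.
move=> s0 e0 noconc hf; pose K := s^-1.
have K0 : 0 < K by rewrite invr_gt0.
pose t := (16 * K ^+ 2)^-1.
have t0 : 0 < t by rewrite invr_gt0 mulr_gt0 ?exprn_gt0.
exists t, ((8 * K)^-1 ^+ 2); split => //; first by rewrite exprn_gt0 ?invr_gt0 ?mulr_gt0.
move=> r r0.
(* The three bounds serve the excess [g], the function [w], and [v], whose rescalings divide the
   energy by [K ^ 2] and [t ^ 2]. *)
pose r' := Num.min (e / 8) (Num.min (r * K ^+ 2) (r * (t * K) ^+ 2)).
have r'0 : 0 < r' by rewrite !lt_min !mulr_gt0 ?exprn_gt0 ?mulr_gt0// invr_gt0.
(* One of the two parts of [f] carries at least half of the square; replace [f] by [- f] if it is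
   the negative one. *)
have [f [f1 ff Ef hf2]] : exists f, [/\ dot f one = 0, dot f f = 1,
    energy P f <= r' & 2^-1 <= dot (vpos f) (vpos f)].
  have [f [f1 ff Ef]] := hf r' r'0.
  have : dot f f = dot (vpos f) (vpos f) + dot (vpos (- f)) (vpos (- f)).
    rewrite [in LHS](vpos_decomp f) !dotE (dotC (vpos (- f)) (vpos f)).
    by rewrite dot_vpos_vneg; ring.
  have [h|h] := leP 2^-1 (dot (vpos f) (vpos f)) => fE; first by exists f.
  exists (- f); split; last by move: h fE; rewrite ff; lra.
  - by rewrite !dotE f1 oppr0.
  - by rewrite !dotE opprK.
  - by rewrite (energyN MP).
move: Ef; rewrite !le_min => /and3P[Ee Ew Ev].
set h := vpos f in hf2; have h0 x : 0 <= h x by exact: vpos_ge0.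
have Eh : energy P h <= energy P f by exact: energy_vpos.
have fE : dot f f = dot h h + dot (vpos (- f)) (vpos (- f)).
  rewrite [in LHS](vpos_decomp f) !dotE (dotC (vpos (- f)) (vpos f)).
  by rewrite dot_vpos_vneg; ring.
have hh1 : dot h h <= 1 by have := dot_sqr_ge0 (vpos (- f)); move: fE; rewrite ff; lra.
have zz1 : dot (vpos (- f)) (vpos (- f)) <= 1.
  by have := dot_sqr_ge0 h; move: fE; rewrite ff; lra.
pose g := vpos (h - K *: one); pose k := trunc K h.
have hE : h = k + g by rewrite /k /g /trunc subrK.
have k0 x : 0 <= k x by rewrite truncE le_min h0 ltW.
have gg : dot g g <= 8^-1.
  rewrite leNgt; apply/negP => gg; apply: (noconc g); split.
  - exact: vpos_ge0.
  - exists (trunc 1 (K^-1 *: h)).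
      split=> x; rewrite truncE l2Z.
        rewrite ge_min lexx orbT le_min ler01 !andbT; apply: mulr_ge0; [by rewrite invr_ge0 ltW|exact: h0].
      have [hK|hK] := leP (h x) K.
        by left; rewrite /g vposE; apply/max_idPr; rewrite !l2E mulr1 subr_le0.
      by right; apply/min_idPr; rewrite ler_pdivlMl// mulr1 ltW.
    apply: (@le_trans _ _ (K^-1 * dot h one)).
      by rewrite -dotZl; apply: dot_le => x; rewrite truncE ler_wpM2r ?l2oneE// ge_min lexx.
    rewrite /K invrK ler_piMr ?(ltW s0)// (le_trans (dot_le_nrm _ _))// nrm_one mulr1.
    by rewrite nrm_le// expr1n.
  - by apply: lt_trans gg; rewrite invr_gt0.
  - have : energy P g <= energy P h.
      by rewrite (le_trans (energy_vpos MP _))// -scaleNr (energyDc MP).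
    nra.
have kk : 8^-1 <= dot k k.
  have := dot_sqrD_le k g; move: hf2; rewrite -hE; lra.
have k1 : (8 * K)^-1 <= dot k one.
  have : dot k k <= K * dot k one.
    rewrite -dotZr; apply: dot_le => x; rewrite l2Z mulr1.
    by apply: ler_wpM2l => //; rewrite truncE ge_min lexx orbT.
  have -> : (8 * K)^-1 = K^-1 * 8^-1 by rewrite invfM mulrC.
  by rewrite ler_pdivrMl//; move: kk; lra.
have Ek : energy P k <= energy P f by exact: le_trans (energy_trunc MP _ _) Eh.
pose u := K^-1 *: k.
have u01 x : 0 <= u x <= 1.
  rewrite l2Z; apply/andP; split; first by apply: mulr_ge0 => //; rewrite invr_ge0 ltW.
  by rewrite ler_pdivrMl// mulr1 truncE ge_min lexx orbT.
have u1 : 2 * t <= dot u one.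
  rewrite dotZl /t; apply: (@le_trans _ _ (K^-1 * (8 * K)^-1)).
    by rewrite le_eqVlt; apply/orP; left; apply/eqP; field; rewrite gt_eqF.
  by rewrite ler_pM2l ?invr_gt0.
have uE : energy P u = K^-1 ^+ 2 * energy P k by rewrite (energyZ MP).
pose w := vpos (u - t *: one); pose v := trunc 1 (t^-1 *: u).
have v01 x : 0 <= v x <= 1.
  rewrite truncE ge_min lexx orbT le_min ler01 !andbT (l2Z t^-1).
  apply: mulr_ge0; first by rewrite invr_ge0 ltW.
  by have /andP[] := u01 x.
exists w, v; split.
- move=> x; rewrite vposE l2D l2N (l2Z t) mulr1; have := u01 x; move: (u x) => y.
  by rewrite /Num.max; case: ltP; lra.
- split=> // x; have [ut|ut] := leP (u x) t.
    by left; rewrite vposE; apply/max_idPr; rewrite l2D l2N (l2Z t) mulr1 subr_le0.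
  by right; rewrite truncE; apply/min_idPr; rewrite (l2Z t^-1) ler_pdivlMl// mulr1 ltW.
- have K2 : 0 < K ^+ 2 by rewrite exprn_gt0.
  have Eu : energy P u <= Num.min r (r * t ^+ 2).
    rewrite uE exprVn le_min !ler_pdivrMl//; apply/andP; split.
      by rewrite mulrC (le_trans Ek).
    rewrite (le_trans Ek)// (le_trans Ev)// le_eqVlt; apply/orP; left; apply/eqP; ring.
  move: Eu; rewrite le_min => /andP[Eu1 Eu2]; split.
    by rewrite (le_trans (energy_vpos MP _))// -scaleNr (energyDc MP).
  rewrite (le_trans (energy_trunc MP _ _))// (energyZ MP) exprVn.
  by rewrite ler_pdivrMl ?exprn_gt0// mulrC.
- have : dot w one >= dot (u - t *: one) one.
    by apply: dot_le => x; rewrite ler_wpM2r ?l2oneE// vposE le_max lexx.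
  rewrite dotBl (dotZl t) dot_one; move: u1; lra.
(* Since [f] is centred, its negative part has the same mean as [h]. It lives where [v = 0], so
   Cauchy-Schwarz bounds [nrm (one - v)] from below, and [(1 - v) ^ 2 <= 1 - v] turns this into a
   bound on the mean. *)
- have z1 : (8 * K)^-1 <= dot (vpos (- f)) one.
    have : dot f one = dot h one - dot (vpos (- f)) one by rewrite -dotBl -vpos_decomp.
    have : dot k one <= dot h one.
      by apply: dot_le => x; rewrite ler_wpM2r ?l2oneE// truncE ge_min lexx.
    by rewrite f1; move: k1; lra.
  have zy : dot (vpos (- f)) one <= dot (vpos (- f)) (one - v).
    apply: dot_le => x; have [fx|fx] := leP 0 (f x).
      by rewrite vposE l2N (max_idPr _) ?oppr_le0// !mul0r.
    have hx : h x = 0 by rewrite /h vposE (max_idPr _) ?ltW.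
    have kx : k x = 0 by rewrite truncE hx (min_idPl _) ?ltW.
    have vx : v x = 0 by rewrite truncE (l2Z t^-1) (l2Z K^-1) kx !mulr0 (min_idPl _).
    by rewrite l2D l2N vx oppr0 addr0.
  have y01 x : 0 <= (one - v) x <= 1.
    by rewrite l2D l2N l2oneE; have := v01 x; lra.
  have a_le : (8 * K)^-1 <= nrm (one - v).
    rewrite (le_trans z1)// (le_trans zy)// (le_trans (dot_le_nrm _ _))//.
    by rewrite ler_piMl ?nrm_ge0// nrm_le// expr1n.
  rewrite lerBrDr -lerBrDl -[X in _ <= X - _](@dot_one _ _ _ mu) -dotBl.
  apply: (@le_trans _ _ (dot (one - v) (one - v))); last first.
    by apply: dot_le => x; rewrite mulr1 ler_piMr//; have /andP[] := y01 x.
  rewrite -nrm_sqr ler_pXn2r// ?nnegrE ?nrm_ge0// invr_ge0.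
  by rewrite mulr_ge0// ltW.
Qed.

Lemma concentration (s e : R) : 0 < s -> 0 < e ->
  (forall r, 0 < r -> exists f, [/\ dot f one = 0, dot f f = 1 & energy P f <= r]) ->
  exists u, concentrated s e u.
Proof.
move=> s0 e0 hf; apply: contrapT => /forallNP noconc.
have [c [q [c0 q0 pairs]]] := nearly_invariant_pairs_of s0 e0 noconc hf.
have q1 : q <= 1.
  by have [w [v [_ [/dot_one_ge0 v0 _] _ _]]] := pairs 1 ltr01; lra.
have [n hn] : exists n, (1 - q / 2) ^+ n <= s by apply: exists_exp_le => //; lra.
(* As [del] depends on [n] but not on the energy, the energy may be asked to be at most
   [e * del ^ 2], hence at most [e * dot b b]. *)
have [del del0 /(_ (e * del ^+ 2))] := shrink_support n c0 q0 pairs.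
rewrite mulr_gt0 ?exprn_gt0// => /(_ isT)[b [chi [b01 bchi Eb db chin]]].
have bb : del ^+ 2 <= dot b b.
  rewrite -nrm_sqr ler_pXn2r ?nnegrE ?nrm_ge0 ?(ltW del0)// (le_trans db)//.
  by rewrite (le_trans (dot_le_nrm _ _))// nrm_one mulr1.
apply: (noconc b); split.
- by move=> x; have /andP[] := b01 x.
- by exists chi => //; exact: le_trans hn.
- by apply: lt_le_trans bb; rewrite exprn_gt0.
- by rewrite (le_trans Eb)// ler_pM2l.
Qed.

(** A normalized concentrated function is almost fixed by [M], and Cauchy-Schwarz on its small
    support makes its mean small, so that subtracting [r] costs little. Only the energy of [M]
    matters, so [M] may be [P] or its symmetrization. *)
Lemma almost_fixed_lower_bound (M : V -> V) n (r e : R) : Markov M ->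
  (forall u, energy M u = energy P u) ->
  (forall r, 0 < r -> exists f, [/\ dot f one = 0, dot f f = 1 & energy P f <= r]) ->
  0 <= r -> 0 < e ->
  exists u, [/\ forall x, 0 <= u x, dot u u = 1 & 1 - e <= dot u (iter n M u - r *: one)].
Proof.
move=> MM EM hf r0 e0.
have arith (x y z : R) : z <= e / 2 -> y <= e / 2 -> - z <= x - 1 -> 1 - e <= x - y.
  by lra.
pose rho := e / 2 / n.+1%:R; pose s := e / 2 / (r + 1).
have r1 : 0 < r + 1 by lra.
have rho0 : 0 < rho by rewrite !divr_gt0.
have s0 : 0 < s by rewrite !divr_gt0.
(* The support bound is squared because the mean is controlled by its square root; [rho ^ 2 / 2] is
   the energy for which [nrmBM_energy] yields [rho]. *)
have [||u [u0 [chi [chi01 uchi] chis] uu Eu]] := concentration (s := s ^+ 2) (e := rho ^+ 2 / 2) _ _ hf.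
- by rewrite exprn_gt0.
- by rewrite divr_gt0 ?exprn_gt0.
have nu0 : 0 < nrm u by rewrite /nrm sqrtr_gt0.
have nuE : (nrm u)^-1 ^+ 2 * dot u u = 1 by rewrite -nrm_sqr -exprMn mulVf ?expr1n ?gt_eqF.
pose v := (nrm u)^-1 *: u.
have vv : dot v v = 1 by rewrite dotZl dotZr mulrA -expr2.
have Ev : energy P v <= rho ^+ 2 / 2.
  rewrite (energyZ MP) (le_trans (ler_wpM2l _ Eu)) ?exprn_ge0 ?invr_ge0 ?nrm_ge0//.
  by rewrite mulrCA nuE mulr1.
have v0 x : 0 <= v x by rewrite l2Z mulr_ge0 ?invr_ge0 ?nrm_ge0.
exists v; split => //.
have nv : nrm v = 1 by rewrite /nrm vv sqrtr1.
have Mv : nrm (M v - v) <= rho.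
  have := nrmBM_energy MM v; rewrite EM nrm_sqr nrm_le ?(ltW rho0)//.
  move: Ev; lra.
have Mnv : nrm (iter n M v - v) <= e / 2.
  rewrite (le_trans (iter_nrm_le _ _ MM))//.
  apply: (@le_trans _ _ (n.+1%:R * rho)).
    by apply: ler_pM => //; rewrite ?nrm_ge0 ?ler_nat.
  by rewrite /rho le_eqVlt; apply/orP; left; apply/eqP; field.
have v1 : dot v one <= s.
  have -> : dot v one = dot v chi.
    apply: eq_Rintegral => x _; rewrite l2oneE.
    by have [ux|->] := uchi x; rewrite ?(l2Z (nrm u)^-1) ?ux ?mulr0 ?mul0r ?mulr1.
  rewrite (le_trans (dot_le_nrm _ _))// nv mul1r nrm_le ?(ltW s0)// (le_trans _ chis)//.
  by apply: dot_le => x; have /andP[? ?] := chi01 x; apply: ler_wpM2l.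
have h2 : r * dot v one <= e / 2.
  apply: (@le_trans _ _ (r * s)); first exact: ler_wpM2l.
  by rewrite /s mulrCA ler_piMr ?divr_ge0 ?(ltW e0)// ler_pdivrMr// mul1r lerDl ler01.
have := abs_dot_le v (iter n M v - v); rewrite nv mul1r ler_norml => /andP[+ _].
by rewrite !dotBr (dotZr r) vv; exact: arith.
Qed.

End concentration.

(** * Consequences of the Poincare inequality *)

Lemma mul_excess_le (R : realType) (k y : R) : 0 <= k -> k * Num.max (y - k) 0 <= y * y.
Proof.
move=> k0; have := sqr_ge0 (y - k); have := sqr_ge0 y.
by rewrite /Num.max; case: ltP => h; nra.
Qed.

Lemma excess_sqr_le (R : realType) (k y : R) : 0 <= k -> 0 <= y ->
  Num.max (y - k) 0 * Num.max (y - k) 0 <= y * y.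
Proof. by move=> k0 y0; rewrite /Num.max; case: ltP => h; nra. Qed.

Section poincare_bounds.
Context {d : measure_display} {T : measurableType d} {R : realType}.
Variable mu : probability T R.
Local Notation V := (l2 mu).
Local Notation one := (l2one mu).
Implicit Types u v w g : V.

Lemma Markov_excess_le (M : V -> V) g (K r : R) : Markov M -> K <= r ->
  ale mu (vpos (M g - r *: one)) (M (vpos (g - K *: one))).
Proof.
move=> MM Kr; set f2 := vpos (g - K *: one).
have f2_ge0 : ale mu (cst 0) (M f2).
  by apply: (Markov_ge0 MM); apply: aeW => x; exact: vpos_ge0.
have Mg : ale mu (M (1 *: g + (- K) *: one)) (M f2).
  apply: (Markov_le MM) => x.
  by rewrite scale1r scaleNr vposE le_max lexx.
apply: filterS2 (filterI f2_ge0 Mg)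
  (filterI (Markov_lin MM 1 (- K) g one) (Markov_one MM)) => x [f20 Mgx] [E1 E2].
move: Mgx; rewrite E1 !l2E E2 l2oneE => h.
by rewrite ge_max; apply/andP; split; [lra|exact: f20].
Qed.

Lemma dot_excess_le g (K : R) : 0 < K -> (forall x, 0 <= g x) -> dot g g <= 1 ->
  dot (vpos (g - K *: one)) one <= K^-1.
Proof.
move=> K0 g0 gg; apply: (@le_trans _ _ (dot (K^-1 *: g) g)).
  apply: dot_le => x; rewrite !l2E !mulr1 -mulrA ler_pdivlMl//.
  by rewrite mul_excess_le// ltW.
by rewrite dotZl ler_piMr// invr_ge0 ltW.
Qed.

Lemma dot_excess_sqr_le g (K : R) : 0 <= K -> (forall x, 0 <= g x) ->
  dot (vpos (g - K *: one)) (vpos (g - K *: one)) <= dot g g.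
Proof.
move=> K0 g0; apply: dot_le => x; rewrite !l2E !mulr1.
exact: excess_sqr_le.
Qed.

Variables (P : V -> V) (a : R).
Hypotheses (MP : Markov P) (a01 : 0 < a <= 1).
Hypothesis gapP : forall u, dot u (P u) <= (1 - a) * dot u u + 2 * dot u one ^+ 2.

Let K := 4 / a.
Let K0 : 0 < K. Proof. by rewrite divr_gt0//; case/andP: a01. Qed.
Let KV : K^-1 = a / 4. Proof. by rewrite /K invf_div. Qed.

Lemma dot_vpos_vabs_le (M : V -> V) u (r : R) : Markov M ->
  dot u (vpos (M u - r *: one)) <= dot (vabs u) (vpos (M (vabs u) - r *: one)).
Proof.
move=> MM; apply: dot_ae.
have : ale mu (M u) (M (vabs u)) by apply: (Markov_le MM) => x; rewrite vabsE ler_norm.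
apply: filterS => x h; have := vpos_ge0 (M u - r *: one) x => p0.
apply: (@le_trans _ _ (vabs u x * vpos (M u - r *: one) x)).
  by apply: ler_wpM2r => //; rewrite vabsE ler_norm.
apply: ler_wpM2l; first by rewrite vabsE.
by rewrite !vposE !l2D ge_max !le_max lerD2r h lexx orbT.
Qed.

(** For [g = |u|], split at [K = 4 / a]. The part below [K] contributes at most [1 / K], because
    [K ^ 2 * (P g - K ^ 2)^+ <= (P g) ^ 2]. On the excess [f2] the tail of [P g] is below [P f2],
    and the gap applies to [f2], whose mean is at most [1 / K]. *)
Lemma tau_bound_of_gap u : dot u u <= 1 ->
  dot u (vpos (P u - K ^+ 2 *: one)) <= 1 - a / 2.
Proof.
have [a0 a1] := andP a01.
have arith (x y z w b : R) : x <= a / 4 -> y <= z -> b <= (a / 4) ^+ 2 ->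
    w <= 1 - a -> z <= w + 2 * b -> x + y <= 1 - a / 2.
  by nra.
rewrite -dot_vabs => uu; rewrite (le_trans (dot_vpos_vabs_le _ _ MP))//.
have g0 x : 0 <= vabs u x by rewrite vabsE.
move: (vabs u) uu g0 => g gg g0.
set W := vpos _; set f2 := vpos (g - K *: one).
have W0 x : 0 <= W x by exact: vpos_ge0.
have f20 x : 0 <= f2 x by exact: vpos_ge0.
have K1 : 1 <= K by rewrite /K ler_pdivlMr//; lra.
have KK : K <= K ^+ 2 by rewrite expr2 ler_peMl// ltW.
have -> : dot g W = dot (trunc K g) W + dot f2 W by rewrite -dotDl /trunc subrK.
have h1 : dot (trunc K g) W <= a / 4.
  apply: (@le_trans _ _ (dot (K *: one) W)).
    apply: dot_le => x; rewrite l2Z mulr1; apply: ler_wpM2r => //.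
    by rewrite truncE ge_min lexx orbT.
  apply: (@le_trans _ _ (dot (K^-1 *: P g) (P g))).
    apply: dot_le => x; rewrite !l2E !mulr1 -(mulrA K^-1) ler_pdivlMl//.
    by rewrite mulrA -expr2 mul_excess_le// exprn_ge0 ?ltW.
  rewrite dotZl -KV ler_piMr ?invr_ge0 ?(ltW K0)//.
  exact: le_trans (Markov_contraction MP g) gg.
have h2 : dot f2 W <= dot f2 (P f2).
  apply: dot_ae; apply: filterS (Markov_excess_le g MP KK) => x h.
  exact: ler_wpM2l.
have h3 : dot f2 one ^+ 2 <= (a / 4) ^+ 2.
  rewrite -KV ler_pXn2r ?nnegrE ?dot_ge0_ptw ?invr_ge0 ?(ltW K0)//.
  exact: dot_excess_le.
have h4 : (1 - a) * dot f2 f2 <= 1 - a.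
  by rewrite ler_piMr ?subr_ge0// (le_trans (dot_excess_sqr_le (ltW K0) g0)).
exact: arith h1 h2 h3 h4 (gapP f2).
Qed.

Hypothesis symP : forall u v, dot (P u) v = dot u (P v).

(** The right side minus the left is [2 <p, P p> + 2 <q, P q>] for the two parts [p], [q] of [u]. *)
Lemma dot_Markov_vabs u : - dot u (P u) <= dot (vabs u) (P (vabs u)).
Proof.
rewrite /vabs {1 2}(vpos_decomp u).
have := dotM_ge0 MP (vpos_ge0 u) (vpos_ge0 u).
have := dotM_ge0 MP (vpos_ge0 (- u)) (vpos_ge0 (- u)).
move: (vpos u) (vpos (- u)) => p q; rewrite !dotE !(dotME MP); lra.
Qed.

(** The tail is dominated by [h = P f2], and by polarization [4 <h, h>] is the difference of the
    forms [<w, P w>] at [w = f2 + h] and [w = f2 - h]. The gap bounds the first directly and the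
    second through [|f2 - h|]; adding the two bounds cancels the cross terms [<f2, h>]. *)
Lemma tail_bound_of_gap u : dot u u <= 1 ->
  nrm (vpos (vabs (P u) - K *: one)) <= Num.sqrt (1 - a / 2).
Proof.
have [a0 a1] := andP a01.
have arith (A D F c X Y Z : R) : A + 2 * D <= (1 - a) * (F + D + 2 * c) + 2 * Y ->
    - (A - 2 * D) <= Z -> Z <= (1 - a) * (F + D - 2 * c) + 2 * X ->
    F <= 1 -> X <= Y -> Y <= (a / 2) ^+ 2 -> D <= 1 - a / 2.
  move=> h1 h2 h3 F1 XY Ya.
  have : (1 - a) * F <= (1 - a) * 1 by rewrite ler_wpM2l// subr_ge0.
  have {}h1 : 4 * D <= (1 - a) * (2 * F + 2 * D) + a ^+ 2 by lra.
  move=> FF; have : D * (2 + 2 * a) <= 2 - 2 * a + a ^+ 2 by lra.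
  have : a ^+ 2 <= a by rewrite expr2 ler_piMr// ltW.
  nra.
rewrite -dot_vabs => uu.
have g0 x : 0 <= vabs u x by rewrite vabsE.
have W1 : ale mu (vpos (vabs (P u) - K *: one)) (vpos (P (vabs u) - K *: one)).
  apply: filterS (Markov_norm_le MP u) => x h.
  by rewrite !vposE !l2D ge_max !le_max lerD2r h lexx orbT.
move: (vabs u) uu g0 W1 => g gg g0 W1.
set f2 := vpos (g - K *: one); set W := vpos (vabs (P u) - _) in W1 *.
have f20 x : 0 <= f2 x by exact: vpos_ge0.
have Wle : dot W W <= dot (P f2) (P f2).
  apply: dot_ae; apply: filterS2 W1 (Markov_excess_le g MP (lexx K)) => x h1 h2.
  by apply: ler_pM; rewrite ?vpos_ge0 ?(le_trans h1).
rewrite /nrm ler_wsqrtr// (le_trans Wle)//.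
have m0 : 0 <= dot f2 one by apply: dot_ge0_ptw.
have m1 : dot f2 one <= a / 4 by rewrite -KV; exact: dot_excess_le.
have ff : dot f2 f2 <= 1 by rewrite (le_trans (dot_excess_sqr_le (ltW K0) g0)).
have h0 : ale mu (cst 0) (P f2) by apply: (Markov_ge0 MP); exact: aeW.
have hm : dot (P f2) one = dot f2 one by exact: (Markov_inv MP).
move: f2 f20 m0 m1 ff h0 hm {Wle} => f2 f20 m0 m1 ff h0 hm.
have D : dot (P f2) (P f2) = dot f2 (P (P f2)) by exact: symP.
move: (P f2) h0 hm D => h h0 hm D.
(* Both functions are nonnegative and [P] preserves means, so [|f2 - h|] has mean at most twice that
   of [f2]. *)
have m2 : dot (vabs (f2 - h)) one <= dot (f2 + h) one.
  apply: dot_ae; apply: filterS h0 => x /= hx; rewrite !mulr1.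
  rewrite -[leRHS]/(f2 x + h x) -[leLHS]/(vabs (f2 - h) x) vabsE l2D l2N.
  by rewrite (le_trans (ler_normB _ _))// !ger0_norm.
have m3 : 0 <= dot (vabs (f2 - h)) one by apply: dot_ge0_ptw => // x; rewrite vabsE.
have {m3} m2' : dot (vabs (f2 - h)) one ^+ 2 <= dot (f2 + h) one ^+ 2.
  by rewrite ler_pXn2r// nnegrE// (le_trans m3).
have m4 : dot (f2 + h) one ^+ 2 <= (a / 2) ^+ 2.
  rewrite ler_pXn2r ?nnegrE; [|by []|by rewrite dotDl hm addr_ge0|by rewrite divr_ge0// ltW].
  by rewrite dotDl hm; lra.
have hPf : dot h (P f2) = dot f2 (P h) by rewrite -symP dotC.
have E1 : dot (f2 + h) (P (f2 + h)) =
    (dot f2 (P f2) + dot h (P h)) + 2 * dot h h.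
  by rewrite !dotE !(dotME MP) hPf D; ring.
have E2 : dot (f2 - h) (P (f2 - h)) =
    (dot f2 (P f2) + dot h (P h)) - 2 * dot h h.
  by rewrite !dotE !(dotME MP) hPf D; ring.
have E3 : dot (f2 + h) (f2 + h) = dot f2 f2 + dot h h + 2 * dot f2 h.
  by rewrite !dotE (dotC h f2); ring.
have E4 : dot (f2 - h) (f2 - h) = dot f2 f2 + dot h h - 2 * dot f2 h.
  by rewrite !dotE (dotC h f2); ring.
have := gapP (f2 + h); have := dot_Markov_vabs (f2 - h); have := gapP (vabs (f2 - h)).
rewrite dot_vabs E1 E2 E3 E4 => g3 g2 g1.
exact: arith g1 g2 g3 ff m2' m4.
Qed.

End poincare_bounds.

(** * Tail norms *)

Section representation.
Context {d : measure_display} {T : measurableType d} {R : realType}.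
Variable mu : probability T R.
Local Notation V := (l2 mu).
Local Notation one := (l2one mu).
Implicit Types (u v : V) (Q : (T -> R) -> (T -> R)) (L : V -> V).

Definition represents Q L := forall u, Q u = L u :> (T -> R).

Lemma represents_iter Q L n : represents Q L -> represents (iter n Q) (iter n L).
Proof. by move=> QL; elim: n => [//|n IH] u; rewrite !iterS IH QL. Qed.

Lemma represents_average Q Q' L L' : represents Q L -> represents Q' L' ->
  represents (symmetrization Q Q') (average L L').
Proof.
move=> QL QL' u; apply/funext => x.
by rewrite /symmetrization QL QL' /average l2Z l2D mulrC.
Qed.

Definition lift Q (LQ : forall f, L2 mu f -> L2 mu (Q f)) : V -> V :=
  fun u => mkL2 (LQ _ (l2P u)).

Lemma l2_of f : L2 mu f -> exists u : V, l2fun u = f.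
Proof. by move=> Lf; exists (mkL2 Lf). Qed.

Lemma dot_oneE u : dot u one = Rintegral mu setT u.
Proof. by apply: eq_Rintegral => x _; rewrite mulr1. Qed.

Lemma integral_sqrE u : (\int[mu]_x (u x ^+ 2)%:E)%E = (dot u u)%:E.
Proof. exact: integral_mulE. Qed.

Lemma unit_ballE : unit_ball mu = [set l2fun u | u in [set u : V | dot u u <= 1]].
Proof.
apply/seteqP; split => [f [/l2_of[u <-]]|_ [u /= uu <-]].
  by rewrite integral_sqrE lee_fin => uu; exists u.
by split; [exact: l2P|rewrite integral_sqrE lee_fin].
Qed.

Lemma represents_linear Q L : represents Q L -> L2_linear_op mu Q ->
  (forall a b u v, aeq mu (L (a *: u + b *: v)) (a *: L u + b *: L v)) /\
  (forall u v, aeq mu u v -> aeq mu (L u) (L v)).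
Proof.
move=> QL [_ Qae Qlin]; split=> [a b u v|u v uv].
  have := Qlin a b u v (l2P u) (l2P v).
  by rewrite -[X in Q X]/(l2fun (a *: u + b *: v)) !QL.
by have := Qae u v (l2P u) (l2P v) uv; rewrite !QL.
Qed.

Lemma represents_Markov Q L : represents Q L -> Markov_op mu Q -> mu_invariant mu Q ->
  Markov L.
Proof.
move=> QL [Qlin Q1 Qpos] Qinv; have [Llin Lae] := represents_linear QL Qlin.
split => //.
- by have := Q1; rewrite -[X in Q X]/(l2fun one) QL.
- by move=> u u0; have := Qpos u (l2P u) u0; rewrite QL.
- by move=> u; rewrite !dot_oneE -QL Qinv//; exact: l2P.
Qed.

Lemma excess_antimono u r r' x : r <= r' ->
  vpos (u - r' *: one) x <= vpos (u - r *: one) x.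
Proof.
move=> rr'; rewrite !vposE ge_max !le_max !l2D !l2N !l2Z lexx orbT andbT.
by rewrite lerD2l lerN2 ler_wpM2r ?l2oneE.
Qed.

Lemma nrm_excess_antimono u r r' : r <= r' ->
  nrm (vpos (u - r' *: one)) <= nrm (vpos (u - r *: one)).
Proof.
move=> rr'; apply: ler_wsqrtr; apply: dot_le => x.
apply: ler_pM; [exact: vpos_ge0|exact: vpos_ge0| |]; exact: excess_antimono.
Qed.

Lemma le_excess_vabs u r x : (u - r *: one) x <= vpos (vabs u - r *: one) x.
Proof.
rewrite vposE le_max; apply/orP; left; rewrite l2D (l2D (vabs u)) vabsE.
by rewrite lerD2r ler_norm.
Qed.

(** The supremum is nonincreasing in [r], so its limit is an infimum. For signed [u] the integrand
    is not monotone in [r]; passing to [|u|] makes it so without lowering the value. *)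
Lemma tau_normE Q L : represents Q L -> Markov L ->
  tau_norm mu Q = ereal_inf (range (fun r : R => ereal_sup
    [set (dot u (vpos (L u - r *: one)))%:E | u in [set u : V | dot u u <= 1]])).
Proof.
move=> QL ML; set G := fun r : R => _.
have -> : tau_norm mu Q = lim (G @ +oo%R).
  rewrite /tau_norm; congr (lim (_ @ +oo%R)); apply/funext => r.
  rewrite unit_ballE image_comp; congr ereal_sup; apply: eq_imagel => u _ /=.
  rewrite -integral_mulE; apply: eq_integral => x _.
  by rewrite QL vposE l2D l2N l2Z mulr1.
apply/cvg_lim => //; apply: nonincreasing_cvge => r r' rr'.
apply: ge_ereal_sup => _ [u /= uu <-].
apply: (@le_trans _ _ (dot (vabs u) (vpos (L (vabs u) - r *: one)))%:E).
  rewrite lee_fin; apply: le_trans (dot_vpos_vabs_le u r' ML) _.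
  apply: dot_le => x; apply: ler_wpM2l; first by rewrite vabsE.
  exact: excess_antimono.
by apply: ereal_sup_ubound; exists (vabs u) => //=; rewrite dot_vabs.
Qed.

Lemma tail_normE Q L : represents Q L ->
  tail_norm mu Q = ereal_inf (range (fun r : R => ereal_sup
    [set (nrm (vpos (vabs (L u) - r *: one)))%:E | u in [set u : V | dot u u <= 1]])).
Proof.
move=> QL; set G := fun r : R => _.
have -> : tail_norm mu Q = lim (G @ +oo%R).
  rewrite /tail_norm; congr (lim (_ @ +oo%R)); apply/funext => r.
  rewrite unit_ballE image_comp; congr ereal_sup; apply: eq_imagel => u _ /=.
  rewrite /nrm -powR12_sqrt ?dot_sqr_ge0// -poweR_EFin -integral_sqrE; congr poweR.
  apply: eq_integral => x _.
  by rewrite QL vposE l2D l2N l2Z mulr1 vabsE.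
apply/cvg_lim => //; apply: nonincreasing_cvge => r r' rr'.
apply: ge_ereal_sup => _ [u /= uu <-].
apply: (@le_trans _ _ (nrm (vpos (vabs (L u) - r *: one)))%:E).
  by rewrite lee_fin nrm_excess_antimono.
by apply: ereal_sup_ubound; exists u.
Qed.

Lemma ereal_inf_sup_lt1 (F : V -> R -> R) (r k : R) : k < 1 ->
  (forall u, dot u u <= 1 -> F u r <= k) ->
  (ereal_inf (range (fun r : R =>
    ereal_sup [set (F u r)%:E | u in [set u : V | (dot u u <= 1)%R]])) < 1)%E.
Proof.
move=> k1 Fk; apply: (@le_lt_trans _ _ k%:E); last by rewrite lte_fin.
apply: le_trans (ereal_inf_lbound _) _; first by exists r.
by apply: ge_ereal_sup => _ [u /= uu <-]; rewrite lee_fin Fk.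
Qed.

Lemma ereal_inf_sup_ge1 (F : V -> R -> R) :
  (forall u r r', (forall x, 0 <= u x) -> r <= r' -> F u r' <= F u r) ->
  (forall r e, 0 <= r -> 0 < e ->
    exists u, [/\ forall x, 0 <= u x, dot u u = 1 & 1 - e <= F u r]) ->
  (1 <= ereal_inf (range (fun r : R =>
    ereal_sup [set (F u r)%:E | u in [set u : V | (dot u u <= 1)%R]])))%E.
Proof.
move=> Fr FE; apply: le_ereal_inf_tmp => _ [r _ <-].
apply/lee_addgt0Pr => e e0.
(* Witnesses are given for nonnegative levels only; monotonicity covers negative [r]. *)
have [|u [u0 uu eF]] := FE (Num.max r 0) e _ e0; first by rewrite le_max lexx orbT.
rewrite -leeBlDr// -EFinB.
apply: (@le_trans _ _ (F u r)%:E).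
  by rewrite lee_fin (le_trans eF)// Fr// le_max lexx.
by apply: ereal_sup_ubound; exists u => //=; rewrite uu.
Qed.

End representation.

(** * Equivalence of the four statements *)

Unset Implicit Arguments.

Theorem theorem1p1 (d : measure_display) (T : measurableType d) (R : realType)
  (mu : probability T R) (P Ps : (T -> R) -> (T -> R)) :
  Markov_op mu P -> mu_invariant mu P -> ergodic mu P -> is_adjoint mu P Ps ->
  [<-> (exists theta : R, -1 <= theta < 1 /\
          forall f, L2 mu f ->
            Rintegral mu setT (fun x => f x ^+ 2) <=
              (1 - theta)^-1 * Rintegral mu setT (fun x => f x * (f x - P f x))
              + (Rintegral mu setT f) ^+ 2);
       (tau_norm mu P < 1)%E;
       (ereal_inf [set tau_norm mu (iter (2 * m - 1) P) | m in [set m : nat | (0 < m)%N]] < 1)%E;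
       (ereal_inf [set tail_norm mu (iter m (symmetrization P Ps)) | m in [set m : nat | (0 < m)%N]] < 1)%E].
Proof.
move=> HP Hinv Herg [Hlin Hadj].
have LP : forall f, L2 mu f -> L2 mu (P f) by case: HP => -[].
have LPs : forall f, L2 mu f -> L2 mu (Ps f) by case: Hlin.
pose p := lift LP; pose ps := lift LPs.
have rP : represents P p by []; have rPs : represents Ps ps by [].
have Mp : Markov p by exact: represents_Markov rP HP Hinv.
have adj (u v : l2 mu) : dot v (p u) = dot (ps v) u.
  exact: (Hadj u v (l2P u) (l2P v)).
have Mps : Markov ps.
  by have [pslin psae] := represents_linear rPs Hlin; exact: Markov_adjoint Mp pslin psae adj.
have erg (u : l2 mu) : aeq mu (p u) u -> exists c, aeq mu u (c *: l2one mu).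
  move=> /(Herg u (l2P u))[c uc]; exists c.
  by apply: filterS uc => x ->; rewrite l2Z mulr1.
pose h := average p ps.
have Mh : Markov h by exact: Markov_average.
have Eh u : energy h u = energy p u by exact: energy_average adj u.
have symh u v : dot (h u) v = dot u (h v) by exact: average_sym adj u v.
have rh : represents (symmetrization P Ps) h by exact: represents_average.
set S1 := (X in [<-> X; _; _; _]); rewrite -/S1.
have gap : S1 -> exists2 a, 0 < a <= 1 &
    forall u : l2 mu, dot u u - energy p u <= (1 - a) * dot u u + 2 * dot u (l2one mu) ^+ 2.
  (* Raising [theta] to at least 0 gives [a <= 1]; the factor 2 bounds [1 - theta], as
     [theta >= -1]. *)
  move=> [theta [/andP[t0 t1] H]]; exists (1 - Num.max theta 0).
    by rewrite subr_gt0 gt_max t1 ltr01 gerBl le_max lexx orbT.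
  move=> u; have := H u (l2P u).
  have -> : Rintegral mu setT (fun x => u x * (u x - P u x)) = energy p u.
    by rewrite /energy -dotBr.
  rewrite -dot_oneE -[Rintegral mu setT _]/(dot u u).
  rewrite -lerBlDr ler_pdivlMl ?subr_gt0//.
  set m := dot u _ ^+ 2; have m0 : 0 <= m by exact: sqr_ge0.
  have : theta * dot u u <= Num.max theta 0 * dot u u.
    by rewrite ler_wpM2r ?dot_sqr_ge0// le_max lexx.
  have : (1 - theta) * m <= 2 * m by rewrite ler_wpM2r//; lra.
  rewrite !subKr /energy; lra.
have near_inv : ~ S1 -> forall r, 0 < r -> exists f : l2 mu,
    [/\ dot f (l2one mu) = 0, dot f f = 1 & energy p f <= r].
  (* The inequality fails for [theta = 1 - e], which lies in [[0, 1)]. The function [u] violating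
     it, once centred and normalized, has energy at most [e <= r]. *)
  move=> nS r r0; pose e := Num.min r 1.
  have e0 : 0 < e by rewrite lt_min r0 ltr01.
  have [u ue] : exists u : l2 mu, e^-1 * energy p u + dot u (l2one mu) ^+ 2 < dot u u.
    apply: contrapT => noe; apply: nS; exists (1 - e); split.
      have e1 : e <= 1 by rewrite ge_min lexx orbT.
      by apply/andP; split; lra.
    move=> f /l2_of[u <-]; rewrite leNgt; apply/negP => lt; apply: noe; exists u.
    move: lt; rewrite subKr -dot_oneE; apply: le_lt_trans.
    by rewrite /energy -dotBr.
  set m := dot u (l2one mu) in ue.
  pose g := u + (- m) *: l2one mu.
  have g1 : dot g (l2one mu) = 0 by rewrite dotDl dotZl dot_one mulr1 subrr.
  have gg : dot g g = dot u u - m ^+ 2.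
    rewrite {2}/g dotDr (dotZr (- m)) g1 mulr0 addr0 dotDl dotZl (dotC _ u) -/m; ring.
  have gE : energy p g = energy p u by exact: energyDc.
  have Ee : energy p g < e * dot g g by rewrite gg gE -ltr_pdivrMl// ltrBrDr.
  have g0 : 0 < dot g g.
    by rewrite -(pmulr_rgt0 _ e0); apply: le_lt_trans Ee; exact: energy_ge0.
  have ng0 : 0 < nrm g by rewrite /nrm sqrtr_gt0.
  have nE : (nrm g)^-1 ^+ 2 * dot g g = 1 by rewrite -nrm_sqr -exprMn mulVf ?expr1n ?gt_eqF.
  exists ((nrm g)^-1 *: g); split.
  - by rewrite (dotZl _ g) g1 mulr0.
  - by rewrite (dotZl _ g) (dotZr _ g) mulrA -expr2.
  - rewrite (energyZ Mp); apply: (@le_trans _ _ ((nrm g)^-1 ^+ 2 * (e * dot g g))).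
      by apply: ler_wpM2l; [rewrite exprn_ge0// invr_ge0 ltW|exact: ltW].
    by rewrite mulrCA nE mulr1 ge_min lexx.
have S12 : S1 -> (tau_norm mu P < 1)%E.
  move=> /gap[a a01 H]; rewrite (tau_normE rP Mp).
  apply: (@ereal_inf_sup_lt1 _ _ _ _ _ ((4 / a) ^+ 2) (1 - a / 2)).
    by case/andP: a01 => a0 _; lra.
  move=> u uu; apply: tau_bound_of_gap => // v.
  by have := H v; rewrite /energy subKr.
have tau_ge n : ~ S1 -> (1 <= tau_norm mu (iter n P))%E.
  move=> /near_inv nS; rewrite (tau_normE (represents_iter n rP) (Markov_iter n Mp)).
  apply: (@ereal_inf_sup_ge1 _ _ _ _ (fun u r => dot u (vpos (iter n p u - r *: l2one mu)))).
    move=> u r r' u0 rr'; apply: dot_le => x.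
    apply: ler_wpM2l; [exact: u0|exact: excess_antimono].
  move=> r e r0 e0.
  have [u [u0 uu ue]] := almost_fixed_lower_bound Mp Mps adj erg n Mp (fun=> erefl) nS r0 e0.
  exists u; split => //; apply: le_trans ue _; apply: dot_le => x; apply: ler_wpM2l => //.
  by rewrite vposE le_max lexx.
have tail_ge n : ~ S1 -> (1 <= tail_norm mu (iter n (symmetrization P Ps)))%E.
  move=> /near_inv nS; rewrite (tail_normE (represents_iter n rh)).
  apply: (@ereal_inf_sup_ge1 _ _ _ _ (fun u r => nrm (vpos (vabs (iter n h u) - r *: l2one mu)))).
    by move=> u r r' _; exact: nrm_excess_antimono.
  move=> r e r0 e0.
  have [u [u0 uu ue]] := almost_fixed_lower_bound Mp Mps adj erg n Mh Eh nS r0 e0.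
  exists u; split => //; apply: le_trans ue _.
  have nu : nrm u = 1 by rewrite /nrm uu sqrtr1.
  rewrite -[leRHS]mul1r -nu; apply: le_trans (dot_le_nrm _ _).
  apply: dot_le => x; apply: ler_wpM2l; [exact: u0|exact: le_excess_vabs].
have S31 : (ereal_inf [set tau_norm mu (iter (2 * m - 1) P) | m in [set m : nat | (0 < m)%N]] < 1)%E -> S1.
  move=> /ereal_inf_lt[_ [m _ <-] lt1]; apply: contrapT => /(tau_ge (2 * m - 1)%N).
  by rewrite leNgt lt1.
have S14 : S1 -> (ereal_inf [set tail_norm mu (iter m (symmetrization P Ps)) | m in [set m : nat | (0 < m)%N]] < 1)%E.
  move=> /gap[a a01 H].
  apply: (@le_lt_trans _ _ (tail_norm mu (iter 1 (symmetrization P Ps)))).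
    by apply: ereal_inf_lbound; exists 1%N.
  rewrite (tail_normE rh).
  apply: (@ereal_inf_sup_lt1 _ _ _ _ _ (4 / a) (Num.sqrt (1 - a / 2))).
    by rewrite -[ltRHS]sqrtr1 ltr_sqrt//; case/andP: a01 => a0 _; lra.
  move=> u uu; apply: tail_bound_of_gap => // v.
  by have := H v; rewrite -Eh /energy subKr.
tfae.
- exact: S12.
(* At [m = 1] the odd power is [P] itself. *)
- move=> lt1; apply: le_lt_trans lt1; apply: ereal_inf_lbound; exists 1%N => //.
- by move=> /S31/S14.
- move=> /ereal_inf_lt[_ [m _ <-] lt1]; apply: contrapT => /(tail_ge m).
  by rewrite leNgt lt1.
Qed.
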